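(* Let $(X,T)$ be a topological dynamical system which is saturated, let $r\ge 1$ and let $\Phi\in C(X^r)$. For $\alpha\in\mathbb{R}$ put $$E_\Phi(\alpha)=\Big\{x\in X:\ \lim_{n\to\infty} n^{-r}\sum_{1\le i_1,\dots,i_r\le n}\Phi(T^{i_1}x,\dots,T^{i_r}x)=\alpha\Big\},\qquad \mathcal{M}_\Phi(\alpha)=\Big\{\mu\in\mathcal{M}_{\rm inv}:\ \int_{X^r}\Phi\,d\mu^{\otimes r}=\alpha\Big\}.$$ If $\mathcal{M}_\Phi(\alpha)=\emptyset$, then $E_\Phi(\alpha)=\emptyset$. If $\mathcal{M}_\Phi(\alpha)\neq\emptyset$, then $$h_{\rm top}(E_\Phi(\alpha))=\sup_{\mu\in\mathcal{M}_\Phi(\alpha)}h_\mu .$$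
   Context: $X$ is a compact metric space with metric $d$ and $T:X\to X$ is continuous. $X^r=X\times\cdots\times X$ ($r$ copies), $C(X^r)$ is the space of real continuous functions on $X^r$, and $\mu^{\otimes r}=\mu\times\cdots\times\mu$ ($r$ copies). $\mathcal{M}_{\rm inv}$ is the set of $T$-invariant Borel probability measures on $X$ and $h_\mu$ the measure-theoretic entropy of $\mu$. Topological entropy of a set (Bowen): for $n\ge1$ let $d_n(x,y)=\max_{0\le j<n}d(T^jx,T^jy)$ and $B_n(x,\epsilon)$ the open $d_n$-ball of radius $\epsilon$ about $x$. For $Z\subset X$, $s\ge0$, $\epsilon>0$, let $H^s_n(Z,\epsilon)=\inf\sum_i e^{-sn_i}$, the infimum over all at most countable covers $\{B_{n_i}(x_i,\epsilon)\}$ of $Z$ with $\min_i n_i\ge n$; let $H^s(Z,\epsilon)=\lim_{n\to\infty}H^s_n(Z,\epsilon)$, let $h_{\rm top}(Z,\epsilon)$ be the critical value of $s$ at which $H^s(Z,\epsilon)$ jumps from $+\infty$ to $0$, and $h_{\rm top}(Z)=\lim_{\epsilon\to0}h_{\rm top}(Z,\epsilon)$. For $\mu\in\mathcal{M}_{\rm inv}$, the set of $\mu$-generic points is $G_\mu=\{x\in X: \frac1n\sum_{j=0}^{n-1}\delta_{T^jx}\to\mu$ weak-star$\}$. The system $(X,T)$ is called saturated if $h_{\rm top}(G_\mu)=h_\mu$ for every $\mu\in\mathcal{M}_{\rm inv}$. *)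

(* Defs.v *)
From mathcomp Require Import all_boot all_order all_algebra.
From mathcomp Require Import all_classical all_reals all_analysis.
Import Order.TTheory GRing.Theory Num.Theory.
Import numFieldNormedType.Exports.

Set Implicit Arguments.
Unset Strict Implicit.
Unset Printing Implicit Defensive.

Local Open Scope classical_set_scope.
Local Open Scope ring_scope.

Section Metric.
Context {R : realType} {X : Type} (dist : X -> X -> R).

Definition is_metric : Prop :=
  [/\ (forall x y, 0 <= dist x y),
      (forall x y, dist x y = 0 <-> x = y),
      (forall x y, dist x y = dist y x) &
      (forall x y z, dist x z <= dist x y + dist y z)].

Definition mopen (A : set X) : Prop :=
  forall x, A x -> exists2 e : R, 0 < e & [set y | dist x y < e] `<=` A.

Definition mcompact : Prop :=
  forall (I : Type) (U : I -> set X), (forall i, mopen (U i)) ->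
    (forall x, exists i, U i x) ->
    exists (k : nat) (f : 'I_k -> I), forall x, exists j, U (f j) x.

Definition mcont (T : X -> X) : Prop :=
  forall x (e : R), 0 < e -> exists2 delta : R, 0 < delta &
    forall y, dist x y < delta -> dist (T x) (T y) < e.

Definition mcont_real (f : X -> R) : Prop :=
  forall x (e : R), 0 < e -> exists2 delta : R, 0 < delta &
    forall y, dist x y < delta -> `|f x - f y| < e.

Definition dist_prod (r : nat) (x y : 'I_r -> X) : R :=
  \big[Num.max/0]_(k < r) dist (x k) (y k).

Definition mcont_prod (r : nat) (Phi : ('I_r -> X) -> R) : Prop :=
  forall x (e : R), 0 < e -> exists2 delta : R, 0 < delta &
    forall y, dist_prod x y < delta -> `|Phi x - Phi y| < e.

Variable T : X -> X.

Definition bowen_dist (n : nat) (x y : X) : R :=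
  \big[Num.max/0]_(j < n) dist (iter j T x) (iter j T y).

Definition bowen_ball (n : nat) (x : X) (eps : R) : set X :=
  [set y | bowen_dist n x y < eps].

Definition Hsn (Z : set X) (eps s : R) (n : nat) : \bar R :=
  ereal_inf [set v : \bar R | exists (I : set nat) (c : nat -> X) (m : nat -> nat),
    [/\ (forall i, I i -> (n <= m i)%N),
        Z `<=` \bigcup_(i in I) bowen_ball (m i) (c i) eps &
        v = (\esum_(i in I) (expR (- (s * (m i)%:R)))%:E)%E]].

(* H^s(Z,eps) = lim_{n->oo} H^s_n(Z,eps); the sequence is nondecreasing in n,
   so the limit is its supremum. *)
Definition Hs (Z : set X) (eps s : R) : \bar R :=
  ereal_sup (range (Hsn Z eps s)).

Definition htop_eps (Z : set X) (eps : R) : \bar R :=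
  ereal_inf [set (s%:E)%E | s in [set s : R | 0 <= s /\ Hs Z eps s = 0%E]].

(* h_top(Z) = lim_{eps -> 0} h_top(Z,eps); h_top(Z,eps) is nonincreasing in eps,
   so the limit is the supremum over eps > 0. *)
Definition htop (Z : set X) : \bar R :=
  ereal_sup [set htop_eps Z eps | eps in [set eps : R | 0 < eps]].

End Metric.

Section Measure.
Context {R : realType} {d : measure_display} {X : measurableType d}.

Definition borel_of (dist : X -> X -> R) : Prop :=
  (measurable : set (set X)) = <<s mopen dist >>.

Variables (T : X -> X) (mu : probability X R).

Definition invariant : Prop :=
  forall A : set X, measurable A -> mu (T @^-1` A) = mu A.

Definition mpartition (k : nat) (P : 'I_k -> set X) : Prop :=
  [/\ (forall i, measurable (P i)),
      (forall i j, i != j -> P i `&` P j = set0) &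
      \bigcup_(i in [set: 'I_k]) P i = setT].

Definition ent_phi (t : R) : R := if t == 0 then 0 else - (t * ln t).

Definition cyl (k n : nat) (P : 'I_k -> set X) (w : {ffun 'I_n -> 'I_k}) : set X :=
  [set x | forall j : 'I_n, P (w j) (iter j T x)].

Definition Hjoin (k n : nat) (P : 'I_k -> set X) : R :=
  \sum_(w : {ffun 'I_n -> 'I_k}) ent_phi (fine (mu (cyl P w))).

Definition hpart (k : nat) (P : 'I_k -> set X) : R :=
  limn (fun n : nat => Hjoin n P / n%:R).

Definition hmu : \bar R :=
  ereal_sup [set v : \bar R | exists (k : nat) (P : 'I_k -> set X),
                mpartition P /\ v = (hpart P)%:E].

(* integral of Phi in L^1(mu^{(x) r}), written as the iterated integral
   (Fubini) over the r coordinates. *)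
Definition ocons (r : nat) (x : X) (y : 'I_r -> X) : 'I_r.+1 -> X :=
  fun i => match unlift ord0 i with Some j => y j | None => x end.

Fixpoint iint (r : nat) : (('I_r -> X) -> R) -> R :=
  match r return (('I_r -> X) -> R) -> R with
  | 0 => fun F => F (fun _ => point)
  | r'.+1 => fun F => Rintegral mu setT (fun x => iint (fun y => F (ocons x y)))
  end.

End Measure.

Section Dyn.
Context {R : realType} {d : measure_display} {X : measurableType d}.
Variables (dist : X -> X -> R) (T : X -> X).

(* mu-generic points: (1/n) sum_{j<n} delta_{T^j x} -> mu weak-star,
   i.e. against every continuous real function on X *)
Definition generic (mu : probability X R) : set X :=
  [set x | forall f : X -> R, mcont_real dist f ->
     (fun n : nat => (n%:R)^-1 * \sum_(j < n) f (iter j T x)) @ \oo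
        --> Rintegral mu setT f].

Definition saturated : Prop :=
  forall mu : probability X R, invariant T mu ->
    htop dist T (generic mu) = hmu T mu.

Definition E_Phi (r : nat) (Phi : ('I_r -> X) -> R) (alpha : R) : set X :=
  [set x | (fun n : nat => ((n%:R) ^+ r)^-1 *
       \sum_(i : {ffun 'I_r -> 'I_n}) Phi (fun k => iter (i k).+1 T x))
     @ \oo --> alpha].

Definition M_Phi (r : nat) (Phi : ('I_r -> X) -> R) (alpha : R)
  : set (probability X R) :=
  [set mu | invariant T mu /\ iint mu Phi = alpha].

End Dyn.

(* Main.v *)
From HB Require Import structures.
Require Import Defs.
From mathcomp Require Import all_boot all_order all_algebra.
From mathcomp Require Import all_classical all_reals all_analysis.
From mathcomp Require Import measurable_realfun ring lra.
Import Order.TTheory GRing.Theory Num.Theory.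
Import numFieldNormedType.Exports.
Set Implicit Arguments.
Unset Strict Implicit.
Unset Printing Implicit Defensive.
Local Open Scope classical_set_scope.
Local Open Scope ring_scope.

(** If [mu] is a limit point of the empirical measures of [x], then the
multiple averages of [Phi] along the orbit of [x] converge, along the same
times, to the integral of [Phi] against the product of copies of [mu].  So
[mu] lies in [M_Phi alpha] when [x] lies in [E_Phi alpha], and such a [mu]
exists by compactness: it represents the limit of the ergodic averages along
an ultrafilter.  Conversely the generic points of a [mu] in [M_Phi alpha] lie
in [E_Phi alpha], and saturation gives the lower bound for the entropy.

The upper bound is Bowen's and does not use saturation.  Let [h_mu <= t].
Take a partition into small pieces with [mu]-null boundary, whose [N]-fold
refinement has entropy less than [N (t + e)], and a code for the words of
length [N] adapted to their distribution under [mu].  For infinitely many [n]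
the itinerary of [x] up to time [n], cut at a suitable offset into blocks of
length [N], has total code length at most [n (t + 2 e)]; by Kraft's inequality
there are about [exp (n (t + 2 e))] such itineraries.  Restricting to rational
code distributions leaves only countably many pairs of an [N] and a code, and
countable unions are harmless for Bowen's entropy. *)

(** * Compactness via ultrafilters *)

(** This form of compactness passes to finite products coordinate by coordinate, because a single
    ultrafilter serves all coordinates at once. [D] is left arbitrary so that it can also be
    [dist_prod]. *)
Definition ultra_compact {R : realType} {Y : Type} (D : Y -> Y -> R) :=
  forall (U : set_system nat), UltraFilter U -> forall u : nat -> Y,
    exists y, forall e : R, 0 < e -> U [set n | D y (u n) < e].

(** Refining [eventually] makes [U] inherit every limit at infinity, and each of its members
    contains arbitrarily large indices. *)
Lemma exists_ultra_infty : exists2 U : set_system nat, UltraFilter U &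
  eventually `<=` U.
Proof.
have [U [UU ?]] := ultraFilterLemma eventually_filter.
by exists U.
Qed.

Lemma ball_mopen (R : realType) (X : Type) (dist : X -> X -> R) (x : X) (e : R) :
  is_metric dist -> mopen dist [set y | dist x y < e].
Proof.
move=> [_ _ _ tri] y /= xy; exists (e - dist x y); first by rewrite subr_gt0.
by move=> z /= yz; apply: le_lt_trans (tri x y z) _; lra.
Qed.

Lemma mcompact_net (R : realType) (X : Type) (dist : X -> X -> R)
    (hm : is_metric dist) (hc : mcompact dist) (e : X -> R) :
  (forall x, 0 < e x) ->
  exists (k : nat) (c : 'I_k -> X), forall x, exists j, dist (c j) x < e (c j).
Proof.
move=> e0; have [//|x|k [c cP]] := hc X (fun x => [set y | dist x y < e x]).
- by move=> x; exact: ball_mopen.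
- by exists x => /=; case: hm => _ /(_ x x)[_ -> //].
- by exists k, c.
Qed.

(** If no point were a limit, each would have a ball that the sequence avoids [U]-almost always.
    Finitely many such balls cover the space, so some term would avoid all of them. *)
Lemma mcompact_ultra (R : realType) (X : Type) (dist : X -> X -> R)
    (hm : is_metric dist) (hc : mcompact dist) : ultra_compact dist.
Proof.
move=> U UU u; apply: contrapT => /forallNP nlim.
have {}nlim x : exists e : R, 0 < e /\ U (~` [set n | dist x (u n) < e]).
  have /existsNP[e /not_implyP[e0 nU]] := nlim x.
  by exists e; split => //; case: (in_ultra_setVsetC [set n | dist x (u n) < e] UU).
have [e eP] := choice nlim.
have [k [c cP]] := mcompact_net hm hc (fun x => (eP x).1).
have : U [set n | forall j, ~ dist (c j) (u n) < e (c j)].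
  by apply: filter_forall => j; exact: (eP (c j)).2.
by move=> /filter_ex [n nP]; have [j] := cP (u n); exact: nP.
Qed.

Section UltraCompact.
Context {R : realType} {Y : Type} (D : Y -> Y -> R).
Hypothesis DC : ultra_compact D.

Lemma ultra_compact_bounded (f : Y -> R) :
  (forall x (e : R), 0 < e -> exists2 delta : R, 0 < delta &
     forall y, D x y < delta -> `|f x - f y| < e) ->
  exists M : R, forall x, `|f x| <= M.
Proof.
move=> fc; apply: contrapT => /forallNP nb.
have {}nb n : exists x, n%:R < `|f x|.
  by have /existsNP[x /negP] := nb n%:R; rewrite -ltNge; exists x.
have [u uP] := choice nb.
have [U UU ooU] := exists_ultra_infty.
have [y yP] := DC UU u.
have [delta d0 dP] := fc y 1 ltr01.
have [n [/= /dP + nbig]] :=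
  filter_ex (filterI (yP _ d0) (ooU _ (nbhs_infty_gtr (`|f y| + 1)))).
have := uP n.
by have := ler_normB (f y) (f y - f (u n)); rewrite subKr; lra.
Qed.

(** Take offending pairs at distance below [n.+1%:R^-1]. A limit of their first components is also a
    limit of the second ones, which contradicts continuity there. *)
Lemma ultra_compact_unif (f : Y -> R) :
  (forall x y z, D x z <= D x y + D y z) ->
  (forall x (e : R), 0 < e -> exists2 delta : R, 0 < delta &
     forall y, D x y < delta -> `|f x - f y| < e) ->
  forall e : R, 0 < e -> exists2 delta : R, 0 < delta &
     forall x y, D x y < delta -> `|f x - f y| < e.
Proof.
move=> tri fc e e0; apply: contrapT => nu.
have {}nu n : exists xy : Y * Y,
    D xy.1 xy.2 < n.+1%:R^-1 /\ e <= `|f xy.1 - f xy.2|.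
  apply: contrapT => /forallNP nex; apply: nu; exists n.+1%:R^-1; first by rewrite invr_gt0.
  move=> x y xy; rewrite ltNge; apply/negP => exy; exact: (nex (x, y)).
have [u uP] := choice nu.
have [U UU ooU] := exists_ultra_infty.
have [y yP] := DC UU (fun n => (u n).1).
have [|delta d0 dP] := fc y (e / 2); first by lra.
have d20 : 0 < delta / 2 by lra.
have [n [/= h1 h2]] :=
  filter_ex (filterI (yP _ d20) (ooU _ (near_infty_natSinv_lt (PosNum d20)))).
have [u1 u2] := uP n.
have {h2 u1}u1 : D (u n).1 (u n).2 < delta / 2 := lt_trans u1 h2.
have /dP k1 : D y (u n).1 < delta.
  by lra.
have /dP k2 : D y (u n).2 < delta.
  by apply: le_lt_trans (tri _ (u n).1 _) _; lra.
have := ler_normB (f y - f (u n).2) (f y - f (u n).1).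
rewrite (_ : f y - f (u n).2 - (f y - f (u n).1) = f (u n).1 - f (u n).2); last by ring.
by lra.
Qed.

End UltraCompact.

Section Product.
Context {R : realType} {X : Type} (dist : X -> X -> R).
Hypothesis hm : is_metric dist.

Lemma dist_prod_lt r (x y : 'I_r -> X) (e : R) : 0 < e ->
  (dist_prod dist x y < e) = [forall k, dist (x k) (y k) < e].
Proof.
move=> e0; apply/idP/forallP => [h k|h].
  by apply: le_lt_trans h; rewrite /dist_prod; exact: le_bigmax.
by rewrite /dist_prod; apply: bigmax_lt => // k _; exact: h.
Qed.

Lemma dist_prod_ge0 r (x y : 'I_r -> X) : 0 <= dist_prod dist x y.
Proof. exact: bigmax_ge_id. Qed.

Lemma dist_prod_tri r (x y z : 'I_r -> X) :
  dist_prod dist x z <= dist_prod dist x y + dist_prod dist y z.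
Proof.
have [_ _ _ tri] := hm.
apply: bigmax_le => [|k _]; first by rewrite addr_ge0 ?dist_prod_ge0.
apply: le_trans (tri _ (y k) _) _; apply: lerD; exact: le_bigmax.
Qed.

Lemma dist_prod_ultra r : ultra_compact dist -> ultra_compact (@dist_prod R X dist r).
Proof.
move=> DC U UU u.
have h k : exists x, forall e : R, 0 < e -> U [set n | dist x (u n k) < e].
  exact: (DC U UU (fun n => u n k)).
have [y yP] := choice h; exists y => e e0.
have : U [set n | forall k, dist (y k) (u n k) < e].
  by apply: filter_forall => k; exact: yP.
by apply: filterS => n nP /=; rewrite dist_prod_lt//; exact/forallP.
Qed.

End Product.

Section Ocons.
Context {R : realType} {d : measure_display} {X : measurableType d}.
Variable dist : X -> X -> R.
Hypothesis hm : is_metric dist.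

Lemma ocons_dist_prod r (x x' : X) (y y' : 'I_r -> X) (e : R) : 0 < e ->
  dist x x' < e -> dist_prod dist y y' < e ->
  dist_prod dist (ocons x y) (ocons x' y') < e.
Proof.
move=> e0 xx'; rewrite !dist_prod_lt// => /forallP yy'; apply/forallP => k.
by rewrite /ocons; case: unlift.
Qed.

Lemma mcont_prod_ocons r (F : ('I_r.+1 -> X) -> R) x :
  mcont_prod dist F -> mcont_prod dist (fun y => F (ocons x y)).
Proof.
move=> Fc y e e0; have [delta d0 dP] := Fc (ocons x y) e e0.
exists delta => // y' yy'; apply: dP; apply: ocons_dist_prod => //.
by case: hm => _ /(_ x x)[_ -> //].
Qed.

End Ocons.

(** * Ergodic averages and multiple averages *)

Definition avg {R : realType} {X : Type} (T : X -> X) (f : X -> R) (x : X) (n : nat) : R :=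
  n%:R^-1 * \sum_(j < n) f (iter j T x).

(** Times start at 1, as in [E_Phi], whereas those of [avg] start at 0, as in [generic];
    [avg_comp_cvg] absorbs the shift. *)
Definition ravg {R : realType} {X : Type} (T : X -> X) (r : nat)
    (Phi : ('I_r -> X) -> R) (x : X) (n : nat) : R :=
  (n%:R ^+ r)^-1 * \sum_(i : {ffun 'I_r -> 'I_n}) Phi (fun k => iter (i k).+1 T x).

Section Averages.
Context {R : realType} {X : Type} (T : X -> X).
Implicit Types (f g : X -> R) (x : X).

(** The weight condition is an inequality so that averages over no terms, where the inverse of 0 is
    0, are covered too. *)
Lemma mean_dist_le (I : finType) (f g : I -> R) (c e : R) : 0 <= e ->
  0 <= c -> c * #|I|%:R <= 1 -> (forall i, `|f i - g i| <= e) ->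
  `|c * \sum_i f i - c * \sum_i g i| <= e.
Proof.
move=> e0 c0 cI fg; rewrite -mulrBr -sumrB normrM ger0_norm//.
apply: (@le_trans _ _ (c * \sum_i e)).
  by apply: ler_wpM2l => //; apply: le_trans (ler_norm_sum _ _ _) _; exact: ler_sum.
rewrite sumr_const -mulr_natl mulrA -[leRHS]mul1r; exact: ler_wpM2r.
Qed.

Lemma natV_mul_le1 (n : nat) : (n%:R : R)^-1 * n%:R <= 1.
Proof.
have [->|n0] := eqVneq n 0%N; first by rewrite mulr0.
by rewrite mulVf// pnatr_eq0.
Qed.

Lemma avg_dist_le f g x n (e : R) : 0 <= e ->
  (forall y, `|f y - g y| <= e) -> `|avg T f x n - avg T g x n| <= e.
Proof.
move=> e0 fg; apply: mean_dist_le; rewrite ?card_ord// ?natV_mul_le1//.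
Qed.

Lemma avg_comp f x n (M : R) : (forall y, `|f y| <= M) ->
  `|avg T (f \o T) x n - avg T f x n| <= n%:R^-1 * (M + M).
Proof.
move=> fM; rewrite /avg -mulrBr normrM ger0_norm ?invr_ge0//.
rewrite ler_wpM2l ?invr_ge0//.
rewrite (_ : _ - _ = f (iter n T x) - f x).
  apply: le_trans (ler_normB _ _) _; exact: lerD.
rewrite -sumrB -(big_mkord xpredT (fun j => f (T (iter j T x)) - f (iter j T x))).
exact: (telescope_sumr (fun j => f (iter j T x))).
Qed.

(** The two averages differ by a telescoping sum of size O(1/n). The filter is kept general: it will
    be an ultrafilter for limit measures and [\oo] for generic points. *)
Lemma avg_comp_cvg (F : set_system nat) (FF : ProperFilter F) f x (M l : R) :
  eventually `<=` F -> (forall y, `|f y| <= M) ->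
  avg T f x @ F --> l -> avg T (f \o T) x @ F --> l.
Proof.
move=> ooF fM fl.
rewrite (_ : avg T (f \o T) x = avg T f x \+ (fun n => avg T (f \o T) x n - avg T f x n)); last first.
  by apply/funext => n /=; rewrite addrC subrK.
rewrite -[l]addr0; apply: cvgD => //.
apply: norm_cvg0.
apply: (@squeeze_cvgr _ _ _ _ (fun=> 0) (fun n : nat => n%:R^-1 * (M + M))).
- by apply: nearW => n /=; rewrite normr_ge0 (avg_comp _ _ fM).
- exact: cvg_cst.
- apply: cvg_trans (_ : (fun n : nat => n%:R^-1 * (M + M)) @ \oo --> 0).
    by move=> A /=; exact: ooF.
  rewrite -[0](mul0r (M + M)); apply: cvgM; last exact: cvg_cst.
  apply/gtr0_cvgV0; last exact: cvgr_idn.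
  by exists 1%N => // n /=; rewrite ltr0n.
Unshelve. all: by end_near. Qed.

Lemma ravg_dist_le r (Phi Psi : ('I_r -> X) -> R) x n (e : R) : 0 <= e ->
  (forall y, `|Phi y - Psi y| <= e) -> `|ravg T Phi x n - ravg T Psi x n| <= e.
Proof.
move=> e0 fg; apply: mean_dist_le => //.
by rewrite card_ffun !card_ord -natrX natV_mul_le1.
Qed.

End Averages.

(** The first index is split off, which matches the recursion of [iint] and prepares the induction
    on the number of coordinates. *)
Lemma ravgS (R : realType) (d : measure_display) (X : measurableType d) (T : X -> X)
    r (Phi : ('I_r.+1 -> X) -> R) x n :
  ravg T Phi x n =
  n%:R^-1 * \sum_(i < n) ravg T (fun y => Phi (ocons (iter i.+1 T x) y)) x n.
Proof.
rewrite /ravg -mulr_sumr mulrA -invfM -exprS; congr (_ * _).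
rewrite pair_big /=.
pose h (p : 'I_n * {ffun 'I_r -> 'I_n}) : {ffun 'I_r.+1 -> 'I_n} :=
  [ffun k => oapp p.2 p.1 (unlift ord0 k)].
pose h' (g : {ffun 'I_r.+1 -> 'I_n}) : 'I_n * {ffun 'I_r -> 'I_n} :=
  (g ord0, [ffun k => g (lift ord0 k)]).
rewrite (reindex h); last first.
  exists h' => [[i f] _|g _]; rewrite /h /h'.
    rewrite ffunE unlift_none/=; congr (_, _).
    by apply/ffunP => k; rewrite !ffunE liftK.
  by apply/ffunP => k; rewrite !ffunE; case: unliftP => [j ->|->] /=; rewrite ?ffunE.
apply: eq_bigr => -[i f] _ /=; congr (Phi _); apply/funext => k.
by rewrite /ocons /h ffunE; case: unlift.
Qed.

(** * Iterated integrals of continuous functions and convergence of multiple averages *)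

Section Integral.
Context {R : realType} {d : measure_display} {X : measurableType d}.
Variables (dist : X -> X -> R) (T : X -> X).
Hypotheses (hm : is_metric dist) (hc : mcompact dist) (hb : borel_of dist).

Lemma mopen_measurable (A : set X) : mopen dist A -> measurable A.
Proof. by rewrite hb => oA; exact: sub_sigma_algebra. Qed.

Lemma mcont_real_gt_mopen (f : X -> R) (a : R) :
  mcont_real dist f -> mopen dist [set x | a < f x].
Proof.
move=> fc x /= ax; have [|delta d0 dP] := fc x (f x - a); first by rewrite subr_gt0.
exists delta => // y /= /dP; have := ler_norm (f x - f y); lra.
Qed.

Lemma mcont_real_measurable (f : X -> R) : mcont_real dist f -> measurable_fun setT f.
Proof.
move=> fc; apply: (measurability _ (RGenOInfty.measurableE R)) => //.
move=> _ [_ [a ->] <-]; rewrite setTI; apply: mopen_measurable.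
rewrite (_ : _ @^-1` _ = [set x | a < f x]); first exact: mcont_real_gt_mopen.
by apply/seteqP; split => x /=; rewrite in_itv/= andbT.
Qed.

Lemma mcont_real_bounded (f : X -> R) : mcont_real dist f -> exists M : R, forall x, `|f x| <= M.
Proof. exact: ultra_compact_bounded (mcompact_ultra hm hc) f. Qed.

Variable mu : probability X R.

Lemma bounded_integrable (f : X -> R) (M : R) : measurable_fun setT f ->
  (forall x, `|f x| <= M) -> mu.-integrable setT (EFin \o f).
Proof.
move=> mf fM; apply: measurable_bounded_integrable => //.
  exact: le_lt_trans (probability_le1 mu measurableT) (ltry _).
by exists M; split; [exact: num_real|move=> x Mx y _ /=; exact: le_trans (fM _) (ltW Mx)].
Qed.

Lemma mcont_real_integrable (f : X -> R) : mcont_real dist f ->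
  mu.-integrable setT (EFin \o f).
Proof.
move=> fc; have [M fM] := mcont_real_bounded fc.
exact: bounded_integrable (mcont_real_measurable fc) fM.
Qed.

Lemma Rintegral_dist_le (f g : X -> R) (e : R) : mcont_real dist f -> mcont_real dist g ->
  (forall x, `|f x - g x| <= e) -> `|Rintegral mu setT f - Rintegral mu setT g| <= e.
Proof.
move=> fc gc fg; rewrite -RintegralB//; [|exact: mcont_real_integrable..].
have ifg : mu.-integrable setT (EFin \o (fun x => f x - g x)).
  apply: bounded_integrable fg; apply: measurable_funB; exact: mcont_real_measurable.
apply: le_trans (le_normr_Rintegral _ ifg) _ => //.
rewrite (_ : e = Rintegral mu setT (fun=> e)); last first.
  by rewrite Rintegral_cst// [X in fine X](_ : _ = 1%E) ?mulr1//; exact: probability_setT.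
apply: le_Rintegral => //.
- apply: (@bounded_integrable _ e) => [|x]; last by rewrite normr_id.
  apply: measurableT_comp => //; apply: measurable_funB; exact: mcont_real_measurable.
- by apply: (@bounded_integrable _ `|e|).
Qed.

Let dist_refl x : dist x x = 0.
Proof. by case: hm => _ /(_ x x)[_ -> //]. Qed.

Lemma ocons_unif r (F : ('I_r.+1 -> X) -> R) : mcont_prod dist F ->
  forall e : R, 0 < e -> exists2 delta : R, 0 < delta & forall x x' y, dist x x' < delta ->
    `|F (ocons x y) - F (ocons x' y)| < e.
Proof.
move=> Fc e e0.
have [delta d0 dP] := ultra_compact_unif (dist_prod_ultra (mcompact_ultra hm hc))
  (@dist_prod_tri _ _ _ hm _) Fc e0.
exists delta => // x x' y xx'; apply: dP; apply: ocons_dist_prod => //.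
by rewrite dist_prod_lt//; apply/forallP => k; rewrite dist_refl.
Qed.

(** Stability and continuity have to be proved together: stability for [r] gives continuity of the
    inner integral for [r.+1], which makes the outer integral legitimate in the stability proof for
    [r.+1]. *)
Lemma iint_ocons_cont_of_stable r :
  (forall F : ('I_r -> X) -> R, mcont_prod dist F -> forall G, mcont_prod dist G ->
     forall e : R, (forall y, `|F y - G y| <= e) -> `|iint mu F - iint mu G| <= e) ->
  forall F : ('I_r.+1 -> X) -> R, mcont_prod dist F ->
  mcont_real dist (fun x => iint mu (fun y : 'I_r -> X => F (ocons x y))).
Proof.
move=> stab F Fc x e e0; have [|delta d0 dP] := ocons_unif Fc (e := e / 2); first by lra.
exists delta => // x' xx'.
apply: (@le_lt_trans _ _ (e / 2)); last by lra.
apply: stab; [exact: mcont_prod_ocons..|].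
by move=> y; exact/ltW/dP.
Qed.

Lemma iint_stable r : forall (F : ('I_r -> X) -> R), mcont_prod dist F ->
  forall G, mcont_prod dist G -> forall e : R,
  (forall y, `|F y - G y| <= e) -> `|iint mu F - iint mu G| <= e.
Proof.
elim: r => [|r IH] F Fc G Gc e FG /=; first exact: FG.
apply: Rintegral_dist_le; [exact: iint_ocons_cont_of_stable..|] => x.
by apply: IH; [exact: mcont_prod_ocons..|] => y; exact: FG.
Qed.

Lemma iint_ocons_cont r (F : ('I_r.+1 -> X) -> R) : mcont_prod dist F ->
  mcont_real dist (fun x => iint mu (fun y : 'I_r -> X => F (ocons x y))).
Proof. exact/iint_ocons_cont_of_stable/iint_stable. Qed.

(* Induction on [r]: the inner averages are equicontinuous in the first
   coordinate, hence converge uniformly, by compactness. *)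
Lemma ravg_cvg (F : set_system nat) (FF : ProperFilter F) x :
  eventually `<=` F ->
  (forall f : X -> R, mcont_real dist f -> avg T f x @ F --> Rintegral mu setT f) ->
  forall r (Phi : ('I_r -> X) -> R), mcont_prod dist Phi ->
  ravg T Phi x @ F --> iint mu Phi.
Proof.
move=> ooF gen; elim=> [|r IH] Phi Phic.
  rewrite (_ : ravg T Phi x = fun=> Phi (fun=> point)); first exact: cvg_cst.
  apply/funext => n; rewrite /ravg expr0 invr1 mul1r.
  rewrite (eq_bigr (fun=> Phi (fun=> point))); last first.
    by move=> i _; congr Phi; apply/funext => -[].
  by rewrite sumr_const card_ffun !card_ord expn0.
set g := fun x => iint mu (fun y : 'I_r -> X => Phi (ocons x y)).
have gc : mcont_real dist g by exact: iint_ocons_cont.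
have [M gM] := mcont_real_bounded gc.
(* The outer index of [ravg] starts at 1, so the average to compare with is that of [g \o T]. *)
have gT := avg_comp_cvg FF ooF gM (gen _ gc).
apply/cvgrPdist_lt => e e0.
have [|delta d0 dP] := ocons_unif Phic (e := e / 5); first by lra.
(* Inner averages are controlled only at the points of a finite net. Moving to and from the net
   costs e/5 each and convergence at the net another e/5; with the outer average the total is
   4e/5. *)
have [k [c cP]] := mcompact_net hm hc (fun=> d0).
have Sg : \forall n \near F, forall j : 'I_k,
    `|g (c j) - ravg T (fun y => Phi (ocons (c j) y)) x n| < e / 5.
  apply: filter_forall => j; move: (IH _ (mcont_prod_ocons hm (c j) Phic)).
  by move=> /cvgrPdist_lt; apply; lra.
have e5 : 0 < e / 5 by lra.
near=> n.
have h1 : `|Rintegral mu setT g - avg T (g \o T) x n| < e / 5.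
  by near: n; move/cvgrPdist_lt : gT; apply.
have h2 (j : 'I_k) : `|g (c j) - ravg T (fun y => Phi (ocons (c j) y)) x n| < e / 5.
  by move: j; near: n.
have h3 y : `|g y - ravg T (fun z => Phi (ocons y z)) x n| <= e / 5 + e / 5 + e / 5.
  have [j cj] := cP y.
  have k1 : `|g y - g (c j)| <= e / 5.
    apply: iint_stable; [exact: mcont_prod_ocons..|] => z.
    by rewrite distrC; exact/ltW/dP.
  have k2 : `|ravg T (fun z => Phi (ocons (c j) z)) x n - ravg T (fun z => Phi (ocons y z)) x n| <= e / 5.
    by apply: ravg_dist_le => [|z]; [lra|exact/ltW/dP].
  have k3 := h2 j.
  apply: le_trans (ler_distD (g (c j)) _ _) _; rewrite -addrA lerD//.
  apply: le_trans (ler_distD (ravg T (fun z => Phi (ocons (c j) z)) x n) _ _) _.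
  by rewrite lerD// ltW.
have h4 : `|avg T (g \o T) x n - ravg T Phi x n| <= e / 5 + e / 5 + e / 5.
  rewrite ravgS; apply: mean_dist_le; rewrite ?card_ord ?natV_mul_le1//; first by lra.
  by move=> i; exact: h3.
rewrite /= -/g; apply: le_lt_trans (ler_distD (avg T (g \o T) x n) _ _) _; lra.
Unshelve. all: by end_near. Qed.

End Integral.

(** * The Riesz representation of a mean *)

Section Clamp.
Context {R : realType}.
Implicit Types t u : R.

Definition c01 t : R := Num.max 0 (Num.min 1 t).

Variant c01_spec t : R -> Type :=
| C01neg of t <= 0 : c01_spec t 0
| C01mid of 0 <= t & t <= 1 : c01_spec t t
| C01big of 1 <= t : c01_spec t 1.

Lemma c01P t : c01_spec t (c01 t).
Proof.
rewrite /c01; case: (leP 1 t) => t1; first by rewrite max_r//; exact: C01big.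
by case: (leP 0 t) => t0; [apply: C01mid; lra|apply: C01neg; lra].
Qed.

Lemma c01_ge0 t : 0 <= c01 t. Proof. by case: c01P; lra. Qed.

Lemma c01_le1 t : c01 t <= 1. Proof. by case: c01P; lra. Qed.

Lemma c01_itv t : 0 <= c01 t <= 1. Proof. by rewrite c01_ge0 c01_le1. Qed.

Lemma c01_lip t u : `|c01 t - c01 u| <= `|t - u|.
Proof.
rewrite ler_norml; have := ler_norm (t - u); have := ler_norm (u - t).
rewrite distrC; case: c01P; case: c01P; move=> *; apply/andP; split; lra.
Qed.

(** A discrete layer-cake decomposition: each layer contributes the part of [t] lying between two
    consecutive integers. *)
Lemma sum_c01 n t : 0 <= t -> \sum_(k < n) c01 (t - k%:R) = Num.min t n%:R.
Proof.
move=> t0; elim: n => [|n IH]; first by rewrite big_ord0 min_r.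
rewrite big_ord_recr/= {}IH -natr1.
case: c01P; case: (leP t n%:R); case: (leP t (n%:R + 1)); lra.
Qed.

End Clamp.

Section Continuity.
Context {R : realType} {X : Type} (dist : X -> X -> R).
Hypothesis hm : is_metric dist.
Implicit Types f g : X -> R.

Lemma mcont_real_lip (f : X -> R) g (K : R) : 0 <= K ->
  mcont_real dist g -> (forall x y, `|f x - f y| <= K * `|g x - g y|) -> mcont_real dist f.
Proof.
move=> K0 gc fg x e e0; have [|delta d0 dP] := gc x (e / (K + 1)).
  by apply: divr_gt0 => //; lra.
exists delta => // y /dP; rewrite ltr_pdivlMr; last by lra.
move=> h; apply: le_lt_trans (fg _ _) _; apply: le_lt_trans h.
by rewrite mulrDr mulr1 mulrC lerDl.
Qed.

Lemma mcont_realD f g : mcont_real dist f -> mcont_real dist g ->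
  mcont_real dist (fun x => f x + g x).
Proof.
move=> fc gc x e e0.
have [|d1 d10 d1P] := fc x (e / 2); first by lra.
have [|d2 d20 d2P] := gc x (e / 2); first by lra.
exists (Num.min d1 d2); first by rewrite lt_min d10.
move=> y; rewrite lt_min => /andP[/d1P h1 /d2P h2].
rewrite opprD addrACA; apply: le_lt_trans (ler_normD _ _) _; lra.
Qed.

Lemma mcont_real_cst (c : R) : mcont_real dist (fun=> c).
Proof. by move=> x e e0; exists 1 => // y _; rewrite subrr normr0. Qed.

Lemma mcont_realZ (c : R) f : mcont_real dist f -> mcont_real dist (fun x => c * f x).
Proof.
move=> fc; apply: (mcont_real_lip (K := `|c|) _ fc) => // x y.
by rewrite -mulrBr normrM.
Qed.

Lemma mcont_real_c01 f : mcont_real dist f -> mcont_real dist (fun x => c01 (f x)).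
Proof.
move=> fc; apply: (mcont_real_lip (K := 1) _ fc) => // x y.
by rewrite mul1r c01_lip.
Qed.

Lemma mcont_real_dist (x : X) : mcont_real dist (dist x).
Proof.
have [_ _ sym tri] := hm.
move=> y e e0; exists e => // z yz; apply: le_lt_trans yz.
have := tri x y z; have := tri x z y; rewrite (sym z y) ler_norml => *.
by apply/andP; split; lra.
Qed.

Lemma mcont_real_sum n (f : 'I_n -> X -> R) : (forall i, mcont_real dist (f i)) ->
  mcont_real dist (fun x => \sum_(i < n) f i x).
Proof.
elim: n f => [|n IH] f fc.
  rewrite (_ : (fun _ => _) = fun=> 0); first exact: mcont_real_cst.
  by apply/funext => x; rewrite big_ord0.
rewrite (_ : (fun _ => _) = fun x => \sum_(i < n) f (widen_ord (leqnSn n) i) x + f ord_max x).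
  by apply: mcont_realD => //; exact: IH.
by apply/funext => x; rewrite big_ord_recr.
Qed.

Lemma mopen_setI (A B : set X) : mopen dist A -> mopen dist B -> mopen dist (A `&` B).
Proof.
move=> oA oB x [/oA[a a0 aP] /oB[b b0 bP]].
exists (Num.min a b); first by rewrite lt_min a0.
by move=> y /=; rewrite lt_min => /andP[/aP ? /bP ?].
Qed.

Lemma mopen_preimage (T : X -> X) (A : set X) : mcont dist T -> mopen dist A ->
  mopen dist (T @^-1` A).
Proof.
move=> Tc oA x /oA[a a0 aP]; have [e e0 eP] := Tc x a a0.
by exists e => // y /eP; exact: aP.
Qed.

Lemma mopen_bigcup (I : Type) (A : I -> set X) : (forall i, mopen dist (A i)) ->
  mopen dist (\bigcup_i A i).
Proof.
move=> oA x [i _ /oA[e e0 eP]]; exists e => // y /eP; by exists i.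
Qed.

Lemma mopen_lt f (a : R) : mcont_real dist f -> mopen dist [set x | f x < a].
Proof.
move=> fc x /= xa; have [|delta d0 dP] := fc x (a - f x); first by rewrite subr_gt0.
by exists delta => // y /= /dP; have := ler_norm (f y - f x); rewrite distrC; lra.
Qed.

End Continuity.

(** * Means: positive normalized linear functionals on bounded functions *)

Definition bnd {R : realType} {X : Type} (f : X -> R) := exists M : R, forall x, `|f x| <= M.

Lemma bndD (R : realType) (X : Type) (f g : X -> R) : bnd f -> bnd g -> bnd (fun x => f x + g x).
Proof.
move=> [M fM] [N gN]; exists (M + N) => x; apply: le_trans (ler_normD _ _) _; exact: lerD.
Qed.

Lemma bndZ (R : realType) (X : Type) (c : R) (f : X -> R) : bnd f -> bnd (fun x => c * f x).
Proof. by move=> [M fM]; exists (`|c| * M) => x; rewrite normrM ler_wpM2l. Qed.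

Lemma bnd_itv (R : realType) (X : Type) (f : X -> R) : (forall x, 0 <= f x <= 1) -> bnd f.
Proof. by move=> f01; exists 1 => x; case/andP: (f01 x) => ? ?; rewrite ger0_norm. Qed.

Lemma bnd_cst (R : realType) (X : Type) (c : R) : bnd (fun _ : X => c).
Proof. by exists `|c|. Qed.

Lemma bnd_sum (R : realType) (X : Type) n (f : 'I_n -> X -> R) : (forall i, bnd (f i)) ->
  bnd (fun x => \sum_(i < n) f i x).
Proof.
move=> fb; have [M fM] := choice fb; exists (\sum_i M i) => x.
by apply: le_trans (ler_norm_sum _ _ _) _; exact: ler_sum.
Qed.

(** In effect a finitely additive probability. The axioms cover all bounded functions, not just
    continuous ones, so that [L] can be evaluated at indicators of visits. *)
Record mean {R : realType} {X : Type} (L : (X -> R) -> R) : Prop := Mean {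
  meanD : forall f g, bnd f -> bnd g -> L (fun x => f x + g x) = L f + L g ;
  meanZ : forall c f, bnd f -> L (fun x => c * f x) = c * L f ;
  mean_le : forall f g, bnd f -> bnd g -> (forall x, f x <= g x) -> L f <= L g ;
  mean1 : L (fun=> 1) = 1 }.

Section Mean.
Context {R : realType} {X : Type} (L : (X -> R) -> R).
Hypothesis mL : mean L.

Lemma mean_cst c : L (fun=> c) = c.
Proof.
rewrite -[RHS]mulr1 -(mean1 mL) -(meanZ mL) ?mulr1//; last exact: bnd_cst.
Qed.

Lemma mean_sum n (f : 'I_n -> X -> R) : (forall i, bnd (f i)) ->
  L (fun x => \sum_(i < n) f i x) = \sum_(i < n) L (f i).
Proof.
elim: n f => [|n IH] f fb.
  rewrite big_ord0 -[RHS](mean_cst 0); by congr L; apply/funext => x; rewrite big_ord0.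
rewrite big_ord_recr/= -IH// -(meanD mL)//; last exact: bnd_sum.
by congr L; apply/funext => x; rewrite big_ord_recr.
Qed.

End Mean.

Lemma mcont_measurable (R : realType) (d : measure_display) (X : measurableType d)
    (dist : X -> X -> R) (hb : borel_of dist) (T : X -> X) : mcont dist T ->
  forall A, measurable A -> measurable (T @^-1` A).
Proof.
move=> Tc; have : measurable_fun setT T.
  apply: (measurability _ hb) => // _ [A oA <-]; rewrite setTI.
  by apply: (mopen_measurable hb); exact: mopen_preimage.
by move=> mT A mA; rewrite -[_ @^-1` _]setTI; exact: mT.
Qed.

(** * From a content on open sets to an outer measure and a Borel probability *)

Section Riesz.
Context {R : realType} {d : measure_display} {X : measurableType d}.
Variable dist : X -> X -> R.
Hypotheses (hm : is_metric dist) (hc : mcompact dist) (hb : borel_of dist).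
Variable L : (X -> R) -> R.
Hypothesis mL : mean L.

Definition adm (G : set X) (f : X -> R) :=
  [/\ mcont_real dist f, (forall x, 0 <= f x <= 1) & (forall x, ~ G x -> f x = 0)].

(** The Riesz content of an open set. Competitors only vanish off [G], without a support condition
    inside [G]; this is why an error [e] appears in [cover_adm]. *)
Definition lam (G : set X) : R := sup [set L f | f in adm G].

Lemma adm0 G : adm G (fun=> 0).
Proof. by split => [|x|//]; [exact: mcont_real_cst|rewrite lexx ler01]. Qed.

Lemma adm_bnd G f : adm G f -> bnd f.
Proof. by case=> _ f01 _; exact: bnd_itv. Qed.

Lemma lam_ub G f : adm G f -> L f <= lam G.
Proof.
move=> Of; apply: ub_le_sup; last by exists f.
exists 1 => _ [g Og <-]; rewrite -(mean_cst mL 1); apply: (mean_le mL) => [||x].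
- exact: adm_bnd Og.
- exact: bnd_cst.
- by case: Og => _ /(_ x)/andP[].
Qed.

Lemma lam_lub G (c : R) : (forall f, adm G f -> L f <= c) -> lam G <= c.
Proof.
move=> Oc; apply: ge_sup; first by exists (L (fun=> 0)), (fun=> 0) => //; exact: adm0.
by move=> _ [f Of <-]; exact: Oc.
Qed.

Lemma lam_ge0 G : 0 <= lam G.
Proof. by rewrite -(mean_cst mL 0); apply: lam_ub; exact: adm0. Qed.

Lemma lam_le1 G : lam G <= 1.
Proof.
apply: lam_lub => f Of; rewrite -(mean_cst mL 1); apply: (mean_le mL) => [||x].
- exact: adm_bnd Of.
- exact: bnd_cst.
- by case: Of => _ /(_ x)/andP[].
Qed.

Lemma le_lam G G' : G `<=` G' -> lam G <= lam G'.
Proof.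
move=> OO'; apply: lam_lub => f [fc f01 f0]; apply: lam_ub; split => // x nO'x.
by apply: f0 => /OO'.
Qed.

Lemma lam_set0 : lam set0 = 0.
Proof.
apply/eqP; rewrite eq_le lam_ge0 andbT; apply: lam_lub => f [_ _ f0].
by rewrite -(mean_cst mL 0) (_ : f = fun=> 0)//; apply/funext => x; exact: f0.
Qed.

Lemma lam_setT : lam setT = 1.
Proof.
apply/eqP; rewrite eq_le lam_le1/= -(mean_cst mL 1); apply: lam_ub.
split => [|x|//]; [exact: mcont_real_cst|by rewrite ler01 lexx|by move=> x /(_ I)].
Qed.

Definition bump (x : X) (r : R) (y : X) : R := c01 (2 - 2 / r * dist x y).

Lemma bump_adm x r (G : set X) : 0 < r -> [set y | dist x y < r] `<=` G -> adm G (bump x r).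
Proof.
move=> r0 rO; split => [|y|y nOy]; last 2 first.
- exact: c01_itv.
- have ry : r <= dist x y by rewrite leNgt; apply/negP => /rO.
  have : 2 <= 2 / r * dist x y by rewrite mulrAC ler_pdivlMr// ler_wpM2l.
  by rewrite /bump; case: c01P => // *; lra.
- apply: mcont_real_c01; apply: mcont_realD; first exact: mcont_real_cst.
  rewrite (_ : (fun _ => _) = (fun y => - (2 / r) * dist x y)).
    by apply: mcont_realZ; exact: mcont_real_dist.
  by apply/funext => y; rewrite mulNr.
Qed.

Lemma bump1 x r y : 0 < r -> dist x y < r / 2 -> bump x r y = 1.
Proof.
move=> r0 xy; rewrite /bump.
have : 2 / r * dist x y <= 1 by rewrite mulrAC ler_pdivrMr// mul1r; lra.
by case: c01P => // *; lra.
Qed.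

Lemma adm_c01_sum n (G : set X) (f : 'I_n -> X -> R) : (forall i, adm G (f i)) ->
  adm G (fun x => c01 (\sum_(i < n) f i x)).
Proof.
move=> fO; split => [|x|x nOx].
- by apply: mcont_real_c01; apply: mcont_real_sum => i; case: (fO i).
- exact: c01_itv.
- rewrite big1 => [|i _]; first by case: c01P => //; lra.
  by case: (fO i) => _ _; exact.
Qed.

(* A finite subcover made of bumps, regrouped according to the index of the
   open set to which they belong. *)
Lemma cover_adm (S : X -> X) (G : nat -> set X) (f : X -> R) (e : R) :
  mcont dist S -> (forall i, mopen dist (G i)) -> adm (\bigcup_i S @^-1` G i) f -> 0 < e ->
  exists (K : nat) (g : nat -> X -> R), (forall i, adm (G i) (g i)) /\
    forall y, f y <= e + \sum_(i < K) g i (S y).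
Proof.
move=> Sc oO [fc f01 f0] e0.
pose P (p : nat * X * R) := 0 < p.2 /\ [set y | dist p.1.2 y < p.2] `<=` G p.1.1.
(* Half-radius balls pulled back by [S], on which a bump equals 1, cover the union. The extra index
   [None] handles the points where [f] is below [e], in particular everything outside the union. *)
pose U (o : option (nat * X * R)) : set X :=
  if o is Some p then [set y | P p /\ dist p.1.2 (S y) < p.2 / 2]
  else [set y | f y < e].
have oU o : mopen dist (U o).
  case: o => [p|] /=; last exact: mopen_lt.
  move=> y [Pp yp].
  have [delta d0 dP] := mopen_preimage Sc (@ball_mopen _ _ _ p.1.2 (p.2 / 2) hm) yp.
  by exists delta => // z /dP zp; split.
have cU y : exists o, U o y.
  have [fy|fy] := ltP (f y) e; first by exists None.
  have [[i _ Oi]|nO] := pselect ((\bigcup_i S @^-1` G i) y); last first.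
    by move: fy; rewrite f0//; lra.
  have [r r0 rO] := oO i _ Oi.
  exists (Some (i, S y, r)) => /=; split => //.
  by case: hm => _ /(_ (S y) (S y))[_ ->]//; lra.
have [k [c cP]] := hc oU cU.
pose h (i : nat) (j : 'I_k) : X -> R :=
  if c j is Some p then if `[< P p >] && (p.1.1 == i) then bump p.1.2 p.2 else fun=> 0
  else fun=> 0.
have hadm i j : adm (G i) (h i j).
  rewrite /h; case: (c j) => [p|]; last exact: adm0.
  case: ifPn => [/andP[/asboolP[p0 pO] /eqP <-]|_]; last exact: adm0.
  exact: bump_adm.
pose g i x := c01 (\sum_(j < k) h i j x).
have g0 i x : 0 <= g i x by exact: c01_ge0.
pose K := (\max_(j < k) (if c j is Some p then p.1.1 else 0)).+1.
exists K, g; split => [i|y]; first exact: adm_c01_sum.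
have [j] := cP y; case oj : (c j) => [p|] /=; last first.
  by move=> /ltW/le_trans; apply; rewrite lerDl sumr_ge0.
move=> [Pp yp]; have pK : (p.1.1 < K)%N.
  rewrite /K ltnS; apply: leq_trans (leq_bigmax j).
  by rewrite oj.
rewrite (bigD1 (Ordinal pK))//=.
have -> : g p.1.1 (S y) = 1.
  have : 1 <= \sum_(j < k) h p.1.1 j (S y).
    rewrite (bigD1 j)//= {1}/h oj asboolT//= eqxx bump1//; last by case: Pp.
    by rewrite lerDl sumr_ge0// => i _; case: (hadm p.1.1 i) => _ /(_ (S y))/andP[].
  by rewrite /g; case: c01P => // *; lra.
have : 0 <= \sum_(i < K | i != Ordinal pK) g i (S y) by rewrite sumr_ge0.
by case/andP: (f01 y) => _; lra.
Qed.

(** Stated with a map [S] to serve twice: [S = id] yields countable subadditivity, and [S = T]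
    yields the inequality behind invariance. *)
Lemma lam_cover (S : X -> X) (G : nat -> set X) :
  mcont dist S -> (forall f, mcont_real dist f -> L (f \o S) = L f) ->
  (forall i, mopen dist (G i)) ->
  ((lam (\bigcup_i S @^-1` G i))%:E <= \sum_(i <oo) (lam (G i))%:E)%E.
Proof.
move=> Sc LS oO; apply/lee_addgt0Pr => e e0.
have s0 : (0 <= \sum_(i <oo) (lam (G i))%:E)%E.
  by apply: nneseries_ge0 => i _ _; rewrite lee_fin lam_ge0.
move sE : (\sum_(i <oo) (lam (G i))%:E)%E s0 => s s0.
case: s sE s0 => [s| |] sE s0 //; last by rewrite addye// leey.
rewrite -EFinD lee_fin; apply: lam_lub => f Of.
have [K [g [gO fg]]] := cover_adm Sc oO Of e0.
have gSb i : bnd (fun y => g i (S y)).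
  by case: (gO i) => _ g01 _; apply: bnd_itv => y; exact: g01.
apply: (@le_trans _ _ (L (fun y => e + \sum_(i < K) g i (S y)))).
  apply: (mean_le mL) => //; first exact: adm_bnd Of.
  by apply: bndD; [exact: bnd_cst|exact: bnd_sum].
rewrite (meanD mL); [|exact: bnd_cst|exact: bnd_sum].
rewrite (mean_cst mL) addrC lerD2r (mean_sum mL)//.
rewrite -lee_fin -sE -sumEFin.
apply: (@le_trans _ _ (\sum_(0 <= i < K) (lam (G i))%:E)%E); last first.
  by apply: nneseries_lim_ge => i _ _; rewrite lee_fin lam_ge0.
rewrite big_mkord; apply: lee_sum => i _; rewrite lee_fin.
by rewrite (LS (g i)); [exact: lam_ub|case: (gO i)].
Qed.

Definition lam_outer (A : set X) : \bar R :=
  ereal_inf [set (lam G)%:E | G in [set G | mopen dist G /\ A `<=` G]].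

Lemma lam_outer_ge0 A : (0 <= lam_outer A)%E.
Proof. by apply: le_ereal_inf_tmp; move=> _ [G _ <-]; rewrite lee_fin lam_ge0. Qed.

Lemma lam_outer_le A G : mopen dist G -> A `<=` G -> (lam_outer A <= (lam G)%:E)%E.
Proof. by move=> oO AO; apply: ereal_inf_lbound; exists G. Qed.

Lemma lam_outer_open G : mopen dist G -> lam_outer G = (lam G)%:E.
Proof.
move=> oO; apply/eqP; rewrite eq_le lam_outer_le//=.
by apply: le_ereal_inf_tmp; move=> _ [G' [_ OO'] <-]; rewrite lee_fin le_lam.
Qed.

Lemma mopen_set0 : mopen dist set0. Proof. by []. Qed.

Lemma mopen_setT : mopen dist setT. Proof. by move=> x _; exists 1. Qed.

Lemma lam_outer_fin A : lam_outer A \is a fin_num.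
Proof.
rewrite ge0_fin_numE ?lam_outer_ge0//.
by apply: le_lt_trans (lam_outer_le mopen_setT _) _ => //; rewrite ltry.
Qed.

Lemma lam_outer0 : lam_outer set0 = 0%E.
Proof. by rewrite lam_outer_open// lam_set0. Qed.

Lemma lam_outer_homo : {homo lam_outer : A B / A `<=` B >-> (A <= B)%E}.
Proof.
move=> A B AB; apply: le_ereal_inf_tmp; move=> _ [G [oO BO] <-].
by apply: lam_outer_le => // x /AB/BO.
Qed.

Lemma lam_outer_adherent A (e : R) : 0 < e ->
  exists G, [/\ mopen dist G, A `<=` G & ((lam G)%:E <= lam_outer A + e%:E)%E].
Proof.
move=> e0; have [_ [G [oO AO] <-] /ltW Oe] := lb_ereal_inf_adherent e0 (lam_outer_fin A).
by exists G.
Qed.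

Lemma lam_outer_subadd : sigma_subadditive lam_outer.
Proof.
move=> A; apply/lee_addgt0Pr => e e0.
rewrite (le_trans _ (epsilon_trick _ (fun i => lam_outer_ge0 _) (ltW e0)))//.
have /choice[G GP] : forall i, exists G, [/\ mopen dist G, A i `<=` G &
    ((lam G)%:E <= lam_outer (A i) + (e / (2 ^ i.+1)%:R)%:E)%E].
  move=> i; apply: lam_outer_adherent; apply: divr_gt0 => //; rewrite ltr0n expn_gt0.
have oO i : mopen dist (G i) by case: (GP i).
apply: (@le_trans _ _ (lam (\bigcup_i G i))%:E).
  apply: lam_outer_le; first exact: mopen_bigcup.
  by move=> x [i _ Aix]; exists i => //; case: (GP i) => _ /(_ _ Aix).
apply: (@le_trans _ _ (\sum_(i <oo) (lam (G i))%:E)%E).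
  apply: (@lam_cover id) => //.
  by move=> x e' e'0; exists e'.
apply: lee_nneseries => [i _ _|i _]; first by rewrite lee_fin lam_ge0.
by case: (GP i).
Qed.

HB.instance Definition _ := isOuterMeasure.Build R X lam_outer
  lam_outer0 lam_outer_ge0 lam_outer_homo lam_outer_subadd.

(* If [f <= 1_(V n G)] and [g <= 1_(V n {f < e})] then [f + g <= (1 + e) 1_V]. *)
Lemma lam_outer_cara_open G V : mopen dist G -> mopen dist V ->
  ((lam (V `&` G))%:E + lam_outer (V `&` ~` G) <= (lam V)%:E)%E.
Proof.
move=> oO oV; rewrite -(fineK (lam_outer_fin _)) -EFinD lee_fin -lerBrDr.
set c := fine _; apply: lam_lub => f [fc f01 f0]; rewrite lerBrDr -lerBrDl.
apply/ler_addgt0Pr => e e0.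
pose W := V `&` [set x | f x < e].
have oW : mopen dist W by apply: mopen_setI => //; exact: mopen_lt.
have VW : V `&` ~` G `<=` W.
  by move=> x [Vx nOx]; split => //=; rewrite f0// => -[].
apply: (@le_trans _ _ (lam W)).
  by rewrite -lee_fin fineK ?lam_outer_fin//; exact: lam_outer_le.
apply: lam_lub => g [gc g01 g0].
have e1 : 0 < 1 + e by lra.
have fb := bnd_itv f01; have gb := bnd_itv g01.
have /lam_ub : adm V (fun x => (1 + e)^-1 * (f x + g x)).
  split => [|x|x nVx].
  - by apply: mcont_realZ; exact: mcont_realD.
  - have /andP[fx0 fx1] := f01 x; have /andP[gx0 gx1] := g01 x.
    have -> : 0 <= (1 + e)^-1 * (f x + g x).
      by rewrite mulr_ge0 ?invr_ge0 ?(ltW e1) ?addr_ge0.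
    rewrite /= ler_pdivrMl// mulr1.
    have [Wx|/g0 ->] := pselect (W x); last by lra.
    by case: Wx => _ /=; lra.
  - by rewrite f0 ?g0 ?addr0 ?mulr0// => -[].
rewrite (meanZ mL); last exact: bndD.
rewrite (meanD mL)// ler_pdivrMl// mulrDl mul1r => h.
have : e * lam V <= e by rewrite ger_pMr// lam_le1.
lra.
Qed.

Lemma measurable_lam_outer : measurable `<=` lam_outer.-caratheodory.
Proof.
rewrite hb; apply: smallest_sub => [|G oO].
  split => [|A mA|A mA].
  - exact: caratheodory_measurable_set0.
  - by rewrite setTD; exact: caratheodory_measurable_setC.
  - exact: caratheodory_measurable_bigcup.
apply: le_caratheodory_measurable => A; apply/lee_addgt0Pr => e e0.
have [V [oV AV Ve]] := lam_outer_adherent A e0.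
apply: le_trans Ve; apply: le_trans (lam_outer_cara_open oO oV).
apply: leeD; last by apply: lam_outer_homo; exact: setSI.
apply: lam_outer_le; first exact: mopen_setI.
exact: setSI.
Qed.

Lemma lam_outer_sigma_additive : semi_sigma_additive (lam_outer : set X -> \bar R).
Proof.
move=> F mF tF mUF; apply: (@caratheodory_measure_sigma_additive R X lam_outer) => //.
  by move=> i; exact: measurable_lam_outer.
exact: measurable_lam_outer.
Qed.

(** An alias that carries the measure structure, while [lam_outer] carries that of an outer
    measure. *)
Definition lam_measure (A : set X) : \bar R := lam_outer A.

HB.instance Definition _ := isMeasure.Build d X R lam_measure
  lam_outer0 lam_outer_ge0 lam_outer_sigma_additive.

Lemma lam_measure_setT : lam_measure setT = 1%E.
Proof. by rewrite /lam_measure lam_outer_open ?lam_setT//; exact: mopen_setT. Qed.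

HB.instance Definition _ := Measure_isProbability.Build d X R lam_measure lam_measure_setT.

Definition riesz : probability X R := lam_measure.

Lemma riesz_open G : mopen dist G -> riesz G = (lam G)%:E.
Proof. exact: lam_outer_open. Qed.

(** The portmanteau inequality for open sets. It keeps track of [L] on indicators, which integrals
    of continuous functions do not see, and later controls visit frequencies. *)
Lemma riesz_open_indic G : mopen dist G -> (riesz G <= (L \1_G)%:E)%E.
Proof.
move=> oG; rewrite riesz_open// lee_fin; apply: lam_lub => f [_ f01 f0].
apply: (mean_le mL) => [||x].
- exact: bnd_itv.
- by apply: bnd_itv => x; rewrite indicE; case: (_ \in _); rewrite ?lexx ?ler01.
- rewrite indicE; case: (boolP (x \in G)) => [_|/negP nGx].
    by case/andP: (f01 x).
  by rewrite f0// => Gx; apply: nGx; rewrite inE.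
Qed.

Local Notation I := (Rintegral riesz setT).
Let icont := mcont_real_integrable hm hc hb riesz.

Lemma riesz_le_integral (A : set X) (g : X -> R) : measurable A -> mcont_real dist g ->
  (forall x, 0 <= g x) -> (forall x, A x -> g x = 1) -> (riesz A <= (I g)%:E)%E.
Proof.
move=> mA gc g0 g1; have -> : riesz A = (I \1_A)%:E.
  rewrite /Rintegral integral_indic// setIT fineK//.
  exact: (@fin_num_measure _ _ _ riesz).
rewrite lee_fin; apply: le_Rintegral => //.
- apply: (@bounded_integrable _ _ _ riesz _ 1) => [|x]; first exact: measurable_indic.
  by case: (_ \in _); rewrite ?normr0 ?normr1.
- exact: icont.
- move=> x _; case: (boolP (x \in A)) => [|_]; last exact: g0.
  by rewrite inE => /g1 ->.
Qed.

Lemma Rintegral_sum_cont n (f : 'I_n -> X -> R) : (forall i, mcont_real dist (f i)) ->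
  I (fun x => \sum_(i < n) f i x) = \sum_(i < n) I (f i).
Proof.
elim: n f => [|n IH] f fc.
  rewrite big_ord0 -[RHS](mul0r (fine (riesz setT))) -Rintegral_cst//.
  by apply: eq_Rintegral => x _; rewrite big_ord0.
rewrite big_ord_recr/= -IH// -RintegralD//; [| |exact: icont].
  by apply: eq_Rintegral => x _; rewrite big_ord_recr.
by apply: icont; exact: mcont_real_sum.
Qed.

(* Slicing [N f] into the layers [c01 (N f - k)], each dominated by the
   indicator of an open superlevel set. *)
Lemma riesz_le_integral01 (f : X -> R) : mcont_real dist f ->
  (forall x, 0 <= f x <= 1) -> L f <= I f.
Proof.
move=> fc f01; rewrite leNgt; apply/negP => If.
(* An additive error independent of [N] is harmless: divide by [N] and let it grow. *)
suff H (N : nat) : N%:R * L f <= N%:R * I f + 1.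
  have := H (Num.bound (L f - I f)^-1); have := archi_boundP (x := (L f - I f)^-1).
  rewrite invr_ge0 subr_ge0 => /(_ (ltW If)).
  rewrite -[_^-1]mul1r ltr_pdivrMr ?subr_gt0// mulrBr; lra.
(* The indicator of [k < N f] lies between [l 0 k] and [l 1 k]; raising [N f] by one unit is what
   produces the additive error 1. *)
pose l (a : R) (k : nat) x := c01 (N%:R * f x + a - k%:R).
have lc a k : mcont_real dist (l a k).
  apply: mcont_real_c01; apply: mcont_realD; last exact: mcont_real_cst.
  by apply: mcont_realD; [exact: mcont_realZ|exact: mcont_real_cst].
have l01 a k x : 0 <= l a k x <= 1 by exact: c01_itv.
have Nf0 x : 0 <= N%:R * f x by case/andP: (f01 x) => ? ?; rewrite mulr_ge0.
have NfN x : N%:R * f x <= N%:R.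
  by case/andP: (f01 x) => ? ?; rewrite -[leRHS]mulr1 ler_wpM2l.
rewrite -(meanZ mL); last exact: bnd_itv.
have -> : (fun x => N%:R * f x) = (fun x => \sum_(k < N) l 0 k x).
  apply/funext => x; rewrite /l; under eq_bigr do rewrite addr0.
  by rewrite sum_c01// min_l.
rewrite (mean_sum mL); last by move=> i; exact: bnd_itv.
apply: (@le_trans _ _ (\sum_(k < N) I (l 1 k))).
  apply: ler_sum => k _.
  pose G := [set x | k%:R < N%:R * f x].
  have oG : mopen dist G by apply: mcont_real_gt_mopen; exact: mcont_realZ.
  have : L (l 0 k) <= lam G.
    apply: lam_ub; split => // x /negP; rewrite -leNgt /l => ?.
    by case: c01P => // *; lra.
  move/le_trans; apply; rewrite -lee_fin -riesz_open//.
  apply: riesz_le_integral => //; first exact: mopen_measurable hb _ oG.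
    by move=> x; exact: c01_ge0.
  by move=> x; rewrite /G/= /l => ?; case: c01P => // *; lra.
rewrite -Rintegral_sum_cont// -RintegralZl//; last exact: icont.
rewrite -[leRHS](_ : I (fun x => N%:R * f x + 1) = _); last first.
  rewrite RintegralD//; [|apply: icont; exact: mcont_realZ|apply: icont; exact: mcont_real_cst].
  by rewrite Rintegral_cst// [X in fine X](_ : _ = 1%E) ?mulr1//; exact: probability_setT.
apply: le_Rintegral => //.
- by apply: icont; exact: mcont_real_sum.
- by apply: icont; apply: mcont_realD; [exact: mcont_realZ|exact: mcont_real_cst].
move=> x _; apply: (@le_trans _ _ (\sum_(k < N.+1) l 1 k x)).
  by rewrite big_ord_recr/= lerDl; case/andP: (l01 1 N x).
by rewrite /l sum_c01 ?addr_ge0// ge_min lexx.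
Qed.

(** The reverse inequality comes from applying [riesz_le_integral01] to [1 - g]. A general
    continuous function is reduced to values in [0,1] by an affine change. *)
Lemma riesz_integral (f : X -> R) : mcont_real dist f -> I f = L f.
Proof.
have H01 (g : X -> R) : mcont_real dist g -> (forall x, 0 <= g x <= 1) -> I g = L g.
  move=> gc g01; apply/eqP; rewrite eq_le riesz_le_integral01// andbT.
  have g'c : mcont_real dist (fun x => 1 + -1 * g x).
    by apply: mcont_realD; [exact: mcont_real_cst|exact: mcont_realZ].
  have := riesz_le_integral01 g'c; have gb := bnd_itv g01.
  rewrite (meanD mL); [|exact: bnd_cst|exact: bndZ].
  rewrite (meanZ mL)// (mean_cst mL) RintegralD//; last 2 first.
  - by apply: icont; exact: mcont_real_cst.
  - by apply: icont; exact: mcont_realZ.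
  rewrite RintegralZl//; last exact: icont.
  rewrite Rintegral_cst// [X in fine X](_ : _ = 1%E) ?mulr1//; last exact: probability_setT.
  move=> h; suff : 1 + -1 * L g <= 1 + -1 * I g by lra.
  by apply: h => x; case/andP: (g01 x) => *; lra.
move=> fc; have [M0 fM0] := mcont_real_bounded hm hc fc.
pose M := `|M0| + 1; have M1 : 0 < M by rewrite /M; have := normr_ge0 M0; lra.
have fM x : `|f x| <= M by apply: le_trans (fM0 x) _; rewrite /M; have := ler_norm M0; lra.
have fE : f = (fun x => (M + M) * ((M + M)^-1 * (f x + M)) + - M).
  by apply/funext => x; rewrite mulrA mulfV ?mul1r ?addrK//; lra.
set g := fun x => (M + M)^-1 * (f x + M) in fE.
have gc : mcont_real dist g.
  by apply: mcont_realZ; apply: mcont_realD => //; exact: mcont_real_cst.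
have g01 x : 0 <= g x <= 1.
  have := fM x; rewrite ler_norml => /andP[? ?].
  have M2 : 0 < M + M by lra.
  by rewrite /g ler_pdivrMl// mulr1 mulr_ge0 ?invr_ge0 ?(ltW M2)//=; lra.
have gb := bnd_itv g01.
rewrite fE (meanD mL); [|exact: bndZ|exact: bnd_cst].
rewrite (meanZ mL)// (mean_cst mL) RintegralD//; last 2 first.
- by apply: icont; exact: mcont_realZ.
- by apply: icont; exact: mcont_real_cst.
rewrite RintegralZl//; last exact: icont.
rewrite Rintegral_cst// [X in fine X](_ : _ = 1%E) ?mulr1//; last exact: probability_setT.
by rewrite H01.
Qed.

(** Outer regularity extends the inequality on open sets to Borel sets, and the same inequality for
    the complement turns it into an equality. *)
Lemma riesz_invariant (T : X -> X) : mcont dist T ->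
  (forall f, mcont_real dist f -> L (f \o T) = L f) -> Defs.invariant T riesz.
Proof.
move=> Tc LT.
have mT := mcont_measurable hb Tc.
have le_inv (A : set X) : measurable A -> (riesz (T @^-1` A) <= riesz A)%E.
  move=> mA; apply/lee_addgt0Pr => e e0.
  have [G [oG AG Ge]] := lam_outer_adherent A e0.
  apply: le_trans Ge; apply: (@le_trans _ _ (lam (T @^-1` G))%:E).
    apply: lam_outer_le; first exact: mopen_preimage.
    by move=> x /AG.
  (* A sequence with a single nonempty term, so that [lam_cover] applies to one open set. *)
  pose Gs (i : nat) := if i == 0%N then G else set0.
  have := @lam_cover T Gs Tc LT; rewrite (_ : \bigcup_i _ = T @^-1` G); last first.
    apply/seteqP; split => [x [i _]|x Gx]; last by exists 0%N.
    by rewrite /Gs /preimage/=; case: ifP.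
  have Gso i : mopen dist (Gs i) by rewrite /Gs; case: ifP => _ //; exact: mopen_set0.
  move=> /(_ Gso)/le_trans; apply.
  rewrite nneseries_recl//; last by move=> *; rewrite lee_fin lam_ge0.
  by rewrite eseries_cond/= eseries0 ?adde0// => -[|]//= k _ _; rewrite lam_set0.
move=> A mA; apply/eqP; rewrite eq_le le_inv//=.
have := le_inv _ (measurableC mA); rewrite -preimage_setC.
rewrite !(@probability_setC _ _ _ riesz)//; last exact: mT.
have fA B : measurable B -> riesz B \is a fin_num by move=> ?; exact: fin_num_measure.
rewrite -[lam_measure A]/(riesz A) -[lam_measure _]/(riesz (T @^-1` A)).
case: (riesz A) (fA _ mA) => [a _| |]//.
case: (riesz (T @^-1` A)) (fA _ (mT _ mA)) => [b _| |]//.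
by rewrite -!EFinB !lee_fin; lra.
Qed.

End Riesz.

(** * Limit points of empirical measures *)

Lemma ultra_cvg (R : realType) (U : set_system nat) (UU : UltraFilter U)
    (u : nat -> R) (M : R) : (forall n, `|u n| <= M) -> cvg (u @ U).
Proof.
move=> uM; have UA : U [set n | `[- M, M]%classic (u n)].
  by apply: filterE => n; have := uM n; rewrite ler_norml /= in_itv.
have [p [_ clp]] := @segment_compact R (- M) M (u @ U) (fmap_proper_filter u _) UA.
apply/cvg_ex; exists p; apply/cvgrPdist_lt => e e0.
have [//|UC] := in_ultra_setVsetC [set n | `|p - u n| < e] UU.
have [||y [/= h1 h2]] := clp [set y | ~ `|p - y| < e] (ball p e).
- exact: UC.
- exact: nbhsx_ballx.
- by exfalso; exact: (h1 h2).
Qed.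

Section MeanSum.
Context {R : realType} {X : Type} (L : (X -> R) -> R).
Hypothesis mL : mean L.

Lemma mean_sum_fin (I : finType) (f : I -> X -> R) : (forall i, bnd (f i)) ->
  L (fun x => \sum_i f i x) = \sum_i L (f i).
Proof.
move=> fb; rewrite [RHS]big_enum_val/= -(mean_sum mL)//.
by congr L; apply/funext => x; rewrite [LHS]big_enum_val.
Qed.

Lemma bnd_indic (A : set X) : bnd (\1_A : X -> R).
Proof. by apply: bnd_itv => x; rewrite indicE; case: (_ \in _); rewrite ?lexx ?ler01. Qed.

Lemma mean_indicC (A : set X) : L \1_(~` A) = 1 - L \1_A.
Proof.
rewrite -(mean_cst mL 1) -[- _]mulN1r -(meanZ mL); last exact: bnd_indic.
rewrite -(meanD mL); [|exact: bnd_cst|exact/bndZ/bnd_indic].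
congr L; apply/funext => x; rewrite !indicE in_setC mulN1r.
by case: (_ \in _); rewrite ?subrr ?subr0.
Qed.

Lemma mean_le_indic (A B : set X) : A `<=` B -> L \1_A <= L \1_B.
Proof.
move=> AB; apply: (mean_le mL) => [||x]; [exact: bnd_indic..|].
rewrite !indicE; case: (boolP (x \in A)) => [|_]; last by rewrite ler0n.
by rewrite inE => /AB; rewrite -inE => ->.
Qed.

End MeanSum.

Section OrbitMean.
Context {R : realType} {X : Type} (T : X -> X) (x : X).
Variables (U : set_system nat) (UU : UltraFilter U) (ooU : eventually `<=` U).

(** Along an ultrafilter this limit exists for every bounded [f], continuous or not; at an indicator
    it is a frequency of visits. *)
Definition omean (f : X -> R) : R := lim (avg T f x @ U).

Lemma avg_omean (f : X -> R) : bnd f -> avg T f x @ U --> omean f.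
Proof.
move=> [M fM]; apply: (ultra_cvg _ (M := `|M|)) => n.
have := @avg_dist_le R X T f (fun=> 0) x n `|M|; rewrite normr_ge0.
have -> : avg T (fun=> 0) x n = 0 :> R by rewrite /avg big1 ?mulr0.
rewrite subr0; apply => // y; rewrite subr0.
exact: le_trans (fM y) (ler_norm M).
Qed.

Lemma omeanE (f : X -> R) (l : R) : avg T f x @ U --> l -> omean f = l.
Proof. by move=> fl; apply: cvg_lim. Qed.

Lemma omean_mean : mean omean.
Proof.
split.
- move=> f g fb gb; apply: omeanE.
  rewrite (_ : avg T _ x = avg T f x \+ avg T g x).
    by apply: cvgD; exact: avg_omean.
  by apply/funext => n; rewrite /avg/= big_split/= mulrDr.
- move=> c f fb; apply: omeanE.
  rewrite (_ : avg T _ x = (fun n => c * avg T f x n)).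
    by apply: cvgM; [exact: cvg_cst|exact: avg_omean].
  by apply/funext => n; rewrite /avg -mulr_sumr mulrCA.
- move=> f g fb gb fg; apply: ler_lim.
  + by apply/cvg_ex; exists (omean f); exact: avg_omean.
  + by apply/cvg_ex; exists (omean g); exact: avg_omean.
  + by apply: nearW => n; rewrite /avg ler_wpM2l ?invr_ge0// ler_sum.
- apply: omeanE; apply: (@cvg_trans _ ((fun=> 1 : R) @ U)); last exact: cvg_cst.
  apply: near_eq_cvg; apply: ooU; exists 1%N => // n /= n0.
  by rewrite /avg sumr_const card_ord mulVf// pnatr_eq0 -lt0n.
Qed.

Lemma omean_comp (f : X -> R) : bnd f -> omean (f \o T) = omean f.
Proof.
move=> fb; have [M fM] := fb; apply: omeanE.
by apply: (avg_comp_cvg _ ooU fM); exact: avg_omean.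
Qed.

End OrbitMean.

Section LimitMeasure.
Context {R : realType} {d : measure_display} {X : measurableType d}.
Variables (dist : X -> X -> R) (T : X -> X).
Hypotheses (hm : is_metric dist) (hc : mcompact dist) (hb : borel_of dist).
Hypothesis hT : mcont dist T.
Variables (U : set_system nat) (UU : UltraFilter U) (ooU : eventually `<=` U).

Lemma mcont_real_bnd (f : X -> R) : mcont_real dist f -> bnd f.
Proof. exact: mcont_real_bounded hm hc f. Qed.

Lemma limit_measure (x : X) : exists mu : probability X R,
  [/\ Defs.invariant T mu,
      forall f, mcont_real dist f -> avg T f x @ U --> Rintegral mu setT f &
      forall G, mopen dist G -> (mu G <= (omean T x U (\1_G))%:E)%E].
Proof.
have mL : mean (omean T x U : (X -> R) -> R) := omean_mean T x UU ooU.
exists (riesz hm hc hb mL); split.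
- apply: riesz_invariant => // f fc; apply: omean_comp => //.
  exact: mcont_real_bnd.
- move=> f fc; rewrite riesz_integral//; apply: avg_omean.
  exact: mcont_real_bnd.
- by move=> G oG; exact: riesz_open_indic.
Qed.

End LimitMeasure.

(** * Labels with null boundary and their frequencies along an orbit *)

Section Frequencies.
Context {R : realType} {d : measure_display} {X : measurableType d}.
Variables (dist : X -> X -> R).
Hypotheses (hm : is_metric dist) (hb : borel_of dist).
Variables (L : (X -> R) -> R) (mL : mean L) (mu : probability X R).
Hypothesis muL : forall G, mopen dist G -> (mu G <= (L \1_G)%:E)%E.

(** This replaces the condition that the pieces of the partition have [mu]-null boundary: the
    exceptional points lie outside an open set of full measure. *)
Definition ae_locally_constant (F : Type) (label : X -> F) :=
  exists G, [/\ mopen dist G, mu G = 1%E & forall y, G y ->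
    exists2 e : R, 0 < e & forall z, dist y z < e -> label z = label y].

Lemma prob_fin (A : set X) : measurable A -> mu A = (fine (mu A))%:E.
Proof. by move=> mA; rewrite fineK//; exact: fin_num_measure. Qed.

Lemma prob_fin0 (A : set X) : 0 <= fine (mu A).
Proof. exact/fine_ge0/measure_ge0. Qed.

Lemma prob_finDI (A B : set X) : measurable A -> measurable B ->
  fine (mu A) = fine (mu (A `\` B)) + fine (mu (A `&` B)).
Proof.
move=> mA mB; apply: EFin_inj; rewrite EFinD -!prob_fin//.
- exact: measureDI.
- exact: measurableI.
- exact: measurableD.
Qed.

Lemma prob_fin_le (A B : set X) : measurable A -> measurable B -> A `<=` B ->
  fine (mu A) <= fine (mu B).
Proof.
by move=> mA mB AB; rewrite -lee_fin -!prob_fin// le_measure ?inE.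
Qed.

Lemma prob_fin1 : fine (mu setT) = 1.
Proof. by rewrite [X in fine X](_ : _ = 1%E)//; exact: probability_setT. Qed.

Lemma prob_finD_full (A G : set X) : measurable A -> measurable G ->
  mu G = 1%E -> fine (mu (A `\` G)) = 0.
Proof.
move=> mA mG G1; apply/eqP; rewrite eq_le prob_fin0 andbT.
have := prob_finDI measurableT mG; rewrite setTI setTD [in X in _ + X]G1 prob_fin1/= => h.
have : fine (mu (A `\` G)) <= fine (mu (~` G)).
  apply: prob_fin_le; [exact: measurableD|exact: measurableC|by move=> x []].
lra.
Qed.

Lemma full_setI (A B : set X) : measurable A -> measurable B ->
  mu A = 1%E -> mu B = 1%E -> mu (A `&` B) = 1%E.
Proof.
move=> mA mB A1 B1; rewrite prob_fin; last exact: measurableI.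
have := prob_finDI mA mB; rewrite prob_finD_full// A1/= add0r => <- //.
Qed.

(** Both [G] meet [A] and [G] minus [A] are open, so [mu] is at most [L] on each. The two measures
    add up to 1 and the two values of [L] to at most 1, which forces equality. *)
Lemma mean_label (F : Type) (label : X -> F) (b : F) :
  ae_locally_constant label -> measurable [set y | label y = b] ->
  L \1_[set y | label y = b] = fine (mu [set y | label y = b]).
Proof.
move=> [G [oG G1 lG]]; set A := [set y | _] => mA.
have oGP (P : set F) : mopen dist (G `&` [set y | P (label y)]).
  move=> y [Gy Py]; have [e e0 eP] := oG y Gy; have [e' e'0 e'P] := lG y Gy.
  exists (Num.min e e'); first by rewrite lt_min e0.
  by move=> z; rewrite /= lt_min => /andP[/eP Gz /e'P lz]; split => //=; rewrite lz.
have mG := mopen_measurable hb oG.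
have oGA : mopen dist (G `&` A) := oGP (fun c => c = b).
have oGA' : mopen dist (G `\` A) := oGP (fun c => c <> b).
have mGA := mopen_measurable hb oGA; have mGA' := mopen_measurable hb oGA'.
have := muL oGA; have := muL oGA'.
rewrite (prob_fin mGA) (prob_fin mGA') !lee_fin.
have := mean_le_indic mL (_ : G `&` A `<=` A).
have := mean_le_indic mL (_ : G `\` A `<=` ~` A).
move=> /(_ (@subIsetr _ _ _)) + /(_ (@subIsetr _ _ _)); rewrite (mean_indicC mL).
have := prob_finDI mG mA; rewrite [in X in X -> _]G1/=.
have := prob_finDI mA mG; rewrite prob_finD_full// setIC; lra.
Qed.

Definition tame (F : finType) (label : X -> F) :=
  ae_locally_constant label /\ forall b, measurable [set y | label y = b].

Lemma tame_comp (F F' : finType) (label : X -> F) (h : F -> F') :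
  tame label -> tame (h \o label).
Proof.
move=> [[G [oG G1 lG]] ml]; split.
  exists G; split => // y /lG[e e0 eP]; exists e => // z /eP /= -> //.
move=> b; rewrite (_ : [set y | _] = \bigcup_(a in [set a | h a = b]) [set y | label y = a]).
  by apply: fin_bigcup_measurable => //; exact: finite_finset.
by apply/seteqP; split => [y /= hy|y /= [a /= <- <-]//]; exists (label y).
Qed.

Lemma full_open_bigcap n (G : 'I_n -> set X) : (forall i, mopen dist (G i)) ->
  (forall i, mu (G i) = 1%E) ->
  mopen dist [set y | forall i, G i y] /\ mu [set y | forall i, G i y] = 1%E.
Proof.
elim: n G => [|n IH] G oG G1.
  rewrite (_ : [set y | _] = setT); last by apply/seteqP; split => // y _ [].
  by split; [exact: mopen_setT|exact: probability_setT].
have [||oH H1] := IH (fun i => G (widen_ord (leqnSn n) i)) => //.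
rewrite (_ : [set y | _] = [set y | forall i, G (widen_ord (leqnSn n) i) y] `&` G ord_max).
  split; first exact: mopen_setI.
  by apply: full_setI => //; [exact: (mopen_measurable hb oH)|exact: (mopen_measurable hb (oG _))].
apply/seteqP; split => [y Gy|y [Hy Gy] i]; first by split => /= *; exact: Gy.
have [ilt|nle] := ltnP i n.
  by have := Hy (Ordinal ilt); congr (G _ y); exact: val_inj.
rewrite (_ : i = ord_max)//; apply: val_inj => /=.
by apply/eqP; rewrite eqn_leq nle -ltnS ltn_ord.
Qed.

Lemma tame_ffun n (F : finType) (label : 'I_n -> X -> F) :
  (forall i, tame (label i)) -> tame (fun y => [ffun i => label i y]).
Proof.
move=> tl; split.
  have /choice[G GP] i := (tl i).1.
  have [oH H1] : mopen dist [set y | forall i, G i y] /\ mu [set y | forall i, G i y] = 1%E.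
    by apply: full_open_bigcap => i; case: (GP i).
  exists [set y | forall i, G i y]; split => // y Gy.
  have /choice[e eP] i : exists e : R, 0 < e /\ forall z, dist y z < e -> label i z = label i y.
    by have [_ _ /(_ y (Gy i))[e e0 eP]] := GP i; exists e.
  exists (\big[Num.min/1]_i e i); first by apply: lt_bigmin => // i _; case: (eP i).
  move=> z yz; apply/ffunP => i; rewrite !ffunE; apply: (eP i).2.
  by apply: lt_le_trans yz _; exact: bigmin_le.
move=> b; rewrite (_ : [set y | _] = \bigcap_(i in [set: 'I_n]) [set y | label i y = b i]).
  apply: fin_bigcap_measurable => [|i _]; first exact: finite_finset.
  exact: (tl i).2.
apply/seteqP; split => [y /= <- i _ /=|y H]; first by rewrite ffunE.
by apply/ffunP => i; rewrite ffunE; exact: H.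
Qed.

Lemma tame_preimage (F : finType) (label : X -> F) (T : X -> X) :
  mcont dist T -> Defs.invariant T mu -> tame label -> tame (label \o T).
Proof.
move=> Tc invT [[G [oG G1 lG]] ml]; split; last first.
  by move=> b; apply: (mcont_measurable hb Tc (ml b)).
exists (T @^-1` G); split.
- exact: mopen_preimage.
- by rewrite (invT _ (mopen_measurable hb oG)).
- move=> y /lG[e e0 eP]; have [e' e'0 e'P] := Tc y e e0.
  by exists e' => // z /e'P/eP.
Qed.

Lemma tame_ball (c : X) (r : R) : mu [set y | dist c y = r] = 0%E ->
  tame (fun y => dist c y < r).
Proof.
move=> Sr; have cc := mcont_real_dist hm c.
have m1 : measurable [set y | dist c y < r].
  exact: (mopen_measurable hb (@ball_mopen _ _ _ c r hm)).
split; last first.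
  case; first exact: m1.
  rewrite (_ : [set y | _] = ~` [set y | dist c y < r]); first exact: measurableC.
  by apply/seteqP; split => y /=; [move=> ->|move/negP/negbTE].
have oG : mopen dist [set y | dist c y <> r].
  move=> y /= yr; have [|d1 d10 d1P] := cc y `|dist c y - r|.
    by rewrite normr_gt0 subr_eq0; exact/eqP.
  by exists d1 => // z /= /d1P h zr; move: h; rewrite zr ltxx.
exists [set y | dist c y <> r]; split => //.
  rewrite prob_fin; last exact: (mopen_measurable hb oG).
  have := prob_finDI measurableT (mopen_measurable hb oG).
  rewrite setTI setTD prob_fin1 (_ : ~` [set y | dist c y <> r] = [set y | dist c y = r]).
    by rewrite Sr/= add0r => <-.
  apply/seteqP; split => y /=; last by move=> ->.
  by move/contrapT.
move=> y /= yr; have [|d1 d10 d1P] := cc y `|dist c y - r|.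
  by rewrite normr_gt0 subr_eq0; exact/eqP.
exists d1 => // z /d1P h.
have [|] := ltP (dist c y) r => yr1; have [|] := ltP (dist c z) r => zr //.
  by move: h; rewrite ltr_norml; move: (yr1) => ?; rewrite ler0_norm; lra.
by move: h; rewrite ltr_norml; move: (yr1) => ?; rewrite ger0_norm; lra.
Qed.

(* Only countably many spheres about [c] are charged. *)
Lemma exists_null_sphere (c : X) (a b : R) : a < b ->
  exists r, a < r < b /\ mu [set y | dist c y = r] = 0%E.
Proof.
move=> ab.
have mf : measurable_fun setT (dist c).
  exact: (mcont_real_measurable hb (mcont_real_dist hm c)).
pose f : {RV mu >-> R} := mfun_Sub (mem_set mf).
have cf : countable [set r | 0 < pmf f r] := pmf_gt0_countable f.
(* The interval is not countable since its Lebesgue measure is positive, so it contains a radius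
   that is not an atom. *)
have [r [rab r0]] : exists r, `]a, b[%classic r /\ ~ 0 < pmf f r.
  apply: contrapT => /forallNP H.
  have sub : `]a, b[%classic `<=` [set r | 0 < pmf f r].
    by move=> r abr; apply: contrapT => nr; exact: (H r).
  have := countable_lebesgue_measure0 (sub_countable (subset_card_le sub) cf).
  rewrite lebesgue_measure_itv/= lte_fin ab -EFinB => /eqP.
  by rewrite eqe subr_eq0 => /eqP E; move: ab; rewrite E ltxx.
exists r; split; first by move: rab; rewrite /= in_itv.
have mS : measurable [set y | dist c y = r].
  have := mf measurableT [set r] (measurable_set1 r).
  by rewrite setTI.
rewrite prob_fin//; congr (_%:E); apply/eqP; rewrite eq_le prob_fin0 andbT leNgt.
by apply/negP => h; apply: r0.
Qed.

Lemma mean_tame (F : finType) (label : X -> F) (g : F -> R) : tame label ->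
  L (g \o label) = \sum_b g b * fine (mu [set y | label y = b]).
Proof.
move=> [lc ml]; rewrite (_ : g \o label =
    (fun y => \sum_b g b * \1_[set y | label y = b] y)); last first.
  apply/funext => y; rewrite (bigD1 (label y))//= big1 => [|b bl].
    by rewrite indicE mem_set// mulr1 addr0.
  rewrite indicE memNset ?mulr0//= => lb; move: bl; by rewrite lb eqxx.
rewrite (mean_sum_fin mL); last by move=> b; exact/bndZ/bnd_indic.
apply: eq_bigr => b _; rewrite (meanZ mL); last exact: bnd_indic.
by rewrite mean_label.
Qed.

End Frequencies.

(** * Entropy *)

Section EntropyInequalities.
Context {R : realType}.

Lemma ent_phiE (t : R) : ent_phi t = - (t * ln t).
Proof. by rewrite /ent_phi; case: eqP => // ->; rewrite mul0r oppr0. Qed.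

Lemma ent_phi_ge0 (t : R) : 0 <= t -> t <= 1 -> 0 <= ent_phi t.
Proof. by move=> t0 t1; rewrite ent_phiE oppr_ge0 mulr_ge0_le0// ln_le0. Qed.

Lemma ln_le_sub1 (x : R) : 0 < x -> ln x <= x - 1.
Proof. by move=> x0; have := expR_ge1Dx (ln x); rewrite lnK ?posrE//; lra. Qed.

(** This is [ln x <= x - 1] at [x = a * b / q], multiplied by [q]. The bounds by [a] and [b] make
    both positive as soon as [q] is. *)
Lemma gibbs_term (a b q : R) : 0 <= q -> q <= a -> q <= b ->
  ent_phi q + q * ln a + q * ln b <= a * b - q.
Proof.
move=> q0 qa qb; rewrite ent_phiE; have [->|qn0] := eqVneq q 0.
  by rewrite !mul0r oppr0 !addr0 mulr_ge0// (le_trans q0).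
have qp : 0 < q by rewrite lt_neqAle eq_sym qn0.
have ap : 0 < a by lra.
have bp : 0 < b by lra.
have : ln (a * b / q) <= a * b / q - 1 by apply: ln_le_sub1; rewrite !(mulr_gt0, invr_gt0).
rewrite ln_div ?posrE ?mulr_gt0// lnM ?posrE//.
move/(ler_wpM2l q0); rewrite !mulrBr mulrDr mulr1 mulrCA mulfV// mulr1; lra.
Qed.

(* Gibbs' inequality against the product of the marginals. *)
Lemma entropy_subadd (A B : finType) (q : A -> B -> R) :
  (forall u v, 0 <= q u v) -> \sum_u \sum_v q u v = 1 ->
  \sum_u \sum_v ent_phi (q u v) <=
  \sum_u ent_phi (\sum_v q u v) + \sum_v ent_phi (\sum_u q u v).
Proof.
move=> q0 q1; set a := fun u => \sum_v q u v; set b := fun v => \sum_u q u v.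
have qa u v : q u v <= a u by rewrite /a (bigD1 v)//= lerDl sumr_ge0.
have qb u v : q u v <= b v by rewrite /b (bigD1 u)//= lerDl sumr_ge0.
have : \sum_u \sum_v (ent_phi (q u v) + q u v * ln (a u) + q u v * ln (b v)) <=
    \sum_u \sum_v (a u * b v - q u v).
  by apply: ler_sum => u _; apply: ler_sum => v _; exact: gibbs_term.
have -> : \sum_u \sum_v (a u * b v - q u v) = 0.
  under eq_bigr do rewrite sumrB -mulr_sumr.
  rewrite sumrB -mulr_suml; have -> : \sum_v b v = 1 by rewrite /b exchange_big.
  by rewrite mulr1 /a subrr.
have -> : \sum_u \sum_v (ent_phi (q u v) + q u v * ln (a u) + q u v * ln (b v)) =
    \sum_u \sum_v ent_phi (q u v) - \sum_u ent_phi (a u) - \sum_v ent_phi (b v).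
  under eq_bigr do rewrite !big_split/= -mulr_suml.
  rewrite !big_split/= -!sumrN; congr (_ + _ + _).
    by apply: eq_bigr => u _; rewrite ent_phiE opprK.
  rewrite exchange_big/=; apply: eq_bigr => v _.
  by rewrite -mulr_suml ent_phiE opprK.
by rewrite -/a; lra.
Qed.

(** The limit is the infimum over positive indices. For a nearly optimal [M], write n as a multiple
    of [M] plus a remainder; [D] bounds the contribution of every remainder and vanishes after
    division by n. *)
Lemma fekete (a : nat -> R) : (forall n, 0 <= a n) ->
  (forall m n, a (m + n)%N <= a m + a n) -> cvgn (fun n => a n / n%:R).
Proof.
move=> a0 asub.
pose S := [set a n.+1 / n.+1%:R | n in [set: nat]].
have S0 : has_inf S.
  split; first by exists (a 1%N / 1%:R); exists 0%N.
  by exists 0 => _ [n _ <-]; rewrite divr_ge0.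
have infS n : (0 < n)%N -> inf S <= a n / n%:R.
  by case: n => // n _; apply: ge_inf; [case: S0|exists n].
apply/cvg_ex; exists (inf S); apply/cvgrPdist_lt => e e0.
have [|_ [N _ <-] Ne] := inf_adherent (eps := e / 2) _ S0; first by lra.
pose M := N.+1; pose D := \sum_(r < M) a r.
have aM q r : a (q * M + r)%N <= q%:R * a M + a r.
  elim: q => [|q IH]; first by rewrite mul0n add0n mul0r add0r.
  rewrite mulSn -addnA; apply: le_trans (asub _ _) _; rewrite -natr1; lra.
have D0 : 0 <= D by exact: sumr_ge0.
have bnd n : (0 < n)%N -> a n / n%:R <= a M / M%:R + D / n%:R.
  move=> n0; have n0' : 0 < n%:R :> R by rewrite ltr0n.
  have M0' : 0 < M%:R :> R by rewrite ltr0n.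
  rewrite ler_pdivrMr// mulrDl [D / _ * _]mulfVK ?gt_eqF//.
  rewrite {1}(divn_eq n M); apply: le_trans (aM _ _) _; apply: lerD.
    rewrite mulrC -mulrA ler_wpM2l// ler_pdivlMl//.
    by rewrite -natrM ler_nat mulnC leq_trunc_div.
  rewrite /D (bigD1 (Ordinal (ltn_pmod n (isT : (0 < M)%N))))//= lerDl.
  exact: sumr_ge0.
have Dn : \forall n \near \oo, D / n%:R < e / 2.
  have := nbhs_infty_gtr (D / (e / 2)); apply: filter_app.
  near=> n => h; have n0 : 0 < n%:R :> R by rewrite ltr0n; near: n; exists 1%N.
  rewrite ltr_pdivrMr//; move: h; rewrite ltr_pdivrMr ?divr_gt0//; lra.
near=> n; have n0 : (0 < n)%N by near: n; exists 1%N.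
have h1 := infS n n0; have h2 := bnd n n0.
have h3 : D / n%:R < e / 2 by near: n.
rewrite distrC ger0_norm; last by rewrite subr_ge0.
by move: Ne; rewrite -/M; lra.
Unshelve. all: by end_near. Qed.

End EntropyInequalities.

(** * Entropy of the words read off by a label *)

Section LabelEntropy.
Context {R : realType} {d : measure_display} {X : measurableType d}.
Variables (T : X -> X) (mu : probability X R).
Hypothesis mT : forall A, measurable A -> measurable (T @^-1` A).
Hypothesis invT : Defs.invariant T mu.

Definition mlabel (F : finType) (label : X -> F) := forall b, measurable [set y | label y = b].

Lemma sum_label (F : finType) (label : X -> F) (A : set X) :
  mlabel label -> measurable A ->
  \sum_b fine (mu (A `&` [set y | label y = b])) = fine (mu A).
Proof.
move=> ml mA; apply: EFin_inj; rewrite -(prob_fin mu mA) -sumEFin.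
rewrite (eq_bigr (fun b => mu (A `&` [set y | label y = b]))); last first.
  by move=> b _; rewrite -prob_fin//; exact: measurableI.
rewrite -[RHS](_ : mu (\bigcup_(b in [set: F]) (A `&` [set y | label y = b])) = _); last first.
  by congr (mu _); apply/seteqP; split => [y [b _ []]//|y Ay]; exists (label y).
rewrite measure_fin_bigcup//.
- rewrite (fsbigE (enum F)) ?enum_uniq//; last by move=> i _; rewrite mem_enum.
  by rewrite big_enum_cond; apply: eq_bigl => i; rewrite in_setT.
- exact: finite_finset.
- by move=> b c _ _ [y [[_ /= <-] [_ /= <-]]].
- by move=> b _; exact: measurableI.
Qed.

Variables (q : nat) (label : X -> 'I_q).
Hypothesis ml : mlabel label.

Definition win (n : nat) (y : X) : {ffun 'I_n -> 'I_q} := [ffun j : 'I_n => label (iter j T y)].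

Lemma iter_measurable n A : measurable A -> measurable (iter n T @^-1` A).
Proof.
elim: n A => [//|n IH] A mA; rewrite (_ : _ @^-1` _ = T @^-1` (iter n T @^-1` A)).
  exact/mT/IH.
by apply/seteqP; split => y /=; rewrite -iterS iterSr.
Qed.

Lemma iter_invariant n A : measurable A -> mu (iter n T @^-1` A) = mu A.
Proof.
elim: n A => [//|n IH] A mA; rewrite -(IH A mA) -(invT (iter_measurable n mA)).
by congr (mu _); apply/seteqP; split => y /=; rewrite -iterS iterSr.
Qed.

Lemma win_mlabel n : mlabel (win n).
Proof.
move=> w; rewrite (_ : [set y | _] = \bigcap_(j in [set: 'I_n])
    iter j T @^-1` [set y | label y = w j]).
  apply: fin_bigcap_measurable => [|j _]; first exact: finite_finset.
  exact/iter_measurable/ml.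
apply/seteqP; split => [y /= <- j _ /=|y H]; first by rewrite ffunE.
by apply/ffunP => j; rewrite ffunE; exact: H.
Qed.

Definition label_part (i : 'I_q) : set X := [set y | label y = i].

Lemma label_mpartition : mpartition label_part.
Proof.
split; first exact: ml.
- move=> i j ij; rewrite -subset0 => y [/= yi yj].
  by move: ij; rewrite -yi yj eqxx.
- by rewrite -subTset => y _; exists (label y).
Qed.

Lemma cyl_win n (w : {ffun 'I_n -> 'I_q}) : cyl T label_part w = [set y | win n y = w].
Proof.
apply/seteqP; split => [y H|y /= <- j]; last by rewrite ffunE.
by apply/ffunP => j; rewrite ffunE; exact: H.
Qed.

Definition winprob n (w : {ffun 'I_n -> 'I_q}) : R := fine (mu [set y | win n y = w]).

Lemma winprob_ge0 n (w : {ffun 'I_n -> 'I_q}) : 0 <= winprob w.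
Proof. exact: prob_fin0. Qed.

Lemma winprob_sum n : \sum_(w : {ffun 'I_n -> 'I_q}) winprob w = 1.
Proof.
rewrite -(prob_fin1 mu) -(sum_label (@win_mlabel n) measurableT).
by apply: eq_bigr => w _; rewrite setTI.
Qed.

Lemma Hjoin_win n : Hjoin T mu n label_part = \sum_(w : {ffun 'I_n -> 'I_q}) ent_phi (winprob w).
Proof. by apply: eq_bigr => w _; rewrite cyl_win. Qed.

Lemma Hjoin_ge0 n : 0 <= Hjoin T mu n label_part.
Proof.
rewrite Hjoin_win; apply: sumr_ge0 => w _; apply: ent_phi_ge0; first exact: winprob_ge0.
by rewrite -(winprob_sum n) (bigD1 w)//= lerDl sumr_ge0// => *; exact: winprob_ge0.
Qed.

(** [entropy_subadd] is applied to the joint law of the first [m] and the next [n] letters; by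
    invariance its second marginal is the law of words of length [n]. *)
Lemma Hjoin_subadd m n :
  Hjoin T mu (m + n) label_part <= Hjoin T mu m label_part + Hjoin T mu n label_part.
Proof.
pose Q (u : {ffun 'I_m -> 'I_q}) (v : {ffun 'I_n -> 'I_q}) : R :=
  fine (mu ([set y | win m y = u] `&` (iter m T @^-1` [set y | win n y = v]))).
have mv v : measurable (iter m T @^-1` [set y | win n y = v]).
  exact/iter_measurable/win_mlabel.
have Q1 u : \sum_v Q u v = winprob u.
  apply: (@sum_label _ (win n \o iter m T)); last exact: win_mlabel.
  by move=> v; exact: mv.
have Q2 v : \sum_u Q u v = winprob v.
  rewrite /winprob -(@iter_invariant m); last exact: win_mlabel.
  rewrite -(@sum_label _ (win m) _ (@win_mlabel m) (mv v)).
  by apply: eq_bigr => u _; rewrite setIC.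
have := @entropy_subadd R _ _ Q (fun u v => prob_fin0 _ _).
under eq_bigr do rewrite Q1; rewrite winprob_sum => /(_ erefl).
under [X in _ <= X + _ -> _]eq_bigr do rewrite Q1.
under [X in _ <= _ + X -> _]eq_bigr do rewrite Q2.
(* What remains is an equality: words of length [m + n] correspond to pairs of words. *)
rewrite -!Hjoin_win; apply: le_trans; rewrite le_eqVlt; apply/orP; left; apply/eqP.
rewrite Hjoin_win pair_big/=.
pose h (p : {ffun 'I_m -> 'I_q} * {ffun 'I_n -> 'I_q}) : {ffun 'I_(m + n) -> 'I_q} :=
  [ffun k => match fintype.split k with inl i => p.1 i | inr j => p.2 j end].
pose h' (w : {ffun 'I_(m + n) -> 'I_q}) : {ffun 'I_m -> 'I_q} * {ffun 'I_n -> 'I_q} :=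
  ([ffun i => w (lshift n i)], [ffun j => w (rshift m j)]).
rewrite (reindex h); last first.
  exists h' => [[u v] _|w _]; rewrite /h /h'.
    congr (_, _); apply/ffunP => i; rewrite !ffunE.
      by rewrite (unsplitK (inl _ i)).
    by rewrite (unsplitK (inr _ i)).
  by apply/ffunP => k; rewrite ffunE; case: split_ordP => j -> /=; rewrite ffunE.
apply: eq_bigr => -[u v] _; congr (ent_phi (fine (mu _))) => /=.
apply/seteqP; split => [y /= /ffunP wy|y [/= /ffunP uy /ffunP vy]].
  split; apply/ffunP => i.
    have := wy (lshift n i); rewrite /h !ffunE /= => ->.
    by rewrite (unsplitK (inl _ i)).
  have := wy (rshift m i); rewrite /h !ffunE /= addnC iterD => ->.
  by rewrite (unsplitK (inr _ i)).
apply/ffunP => k; rewrite /h !ffunE; case: split_ordP => j -> /=.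
  by have := uy j; rewrite ffunE.
by have := vy j; rewrite ffunE addnC iterD.
Qed.

Lemma hpart_cvg : (fun n => Hjoin T mu n label_part / n%:R) @ \oo --> hpart T mu label_part.
Proof. by apply: fekete; [exact: Hjoin_ge0|exact: Hjoin_subadd]. Qed.

Lemma exists_Hjoin_lt (t : R) : hpart T mu label_part < t ->
  exists2 N : nat, (0 < N)%N & Hjoin T mu N label_part < N%:R * t.
Proof.
move=> ht; have h0 : 0 < t - hpart T mu label_part by rewrite subr_gt0.
have /cvgrPdist_lt /(_ _ h0) := hpart_cvg.
move=> /(filterI (nbhs_infty_gt 0))/filter_ex[N [/= N0 HN]].
exists N => //; have N0' : 0 < N%:R :> R by rewrite ltr0n.
by rewrite mulrC -ltr_pdivrMr//; move: HN; rewrite ltr_norml => /andP[]; lra.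
Qed.

End LabelEntropy.

Lemma hmu_ge0 (R : realType) (d : measure_display) (X : measurableType d) (T : X -> X)
  (mu : probability X R) : (0 <= hmu T mu)%E.
Proof.
pose P (_ : 'I_1) := [set: X].
have hP : hpart T mu P = 0.
  apply: cvg_lim => //; rewrite (_ : (fun _ => _) = fun=> 0); first exact: cvg_cst.
  apply/funext => n; rewrite /Hjoin big1 ?mul0r// => w _.
  rewrite (_ : cyl T P w = setT); last by apply/seteqP; split.
  by rewrite prob_fin1 ent_phiE ln1 mulr0 oppr0.
apply: ereal_sup_ubound; exists 1%N, P; split; last by rewrite hP.
split.
- by move=> i; exact: measurableT.
- by move=> i j; rewrite (ord1 i) (ord1 j) eqxx.
- by rewrite -subTset => y _; exists ord0.
Qed.

(* A countable family of codes: the Shannon code lengths, in nats, of the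
   probability vectors with rational positive entries. *)
Section Codes.
Context {R : realType} (A : finType).
Implicit Types v : {ffun A -> nat}.

Definition code_len v (b : A) : R :=
  ln (\sum_(c : A) (v c).+1%:R) - ln (v b).+1%:R.

Let vS v b : (v b).+1%:R <= \sum_(c : A) (v c).+1%:R :> R.
Proof. by rewrite (bigD1 b)//= lerDl sumr_ge0. Qed.

Let S0 v (b : A) : 0 < \sum_(c : A) (v c).+1%:R :> R.
Proof. by apply: lt_le_trans (vS v b); rewrite ltr0n. Qed.

Lemma code_len_ge0 v b : 0 <= code_len v b.
Proof. by rewrite /code_len subr_ge0 ler_ln ?posrE ?ltr0n ?vS ?(S0 v b). Qed.

Lemma kraft v : \sum_b expR (- code_len v b) <= 1.
Proof.
have [a _|A0] := pickP (xpredT : pred A); last by rewrite big_pred0.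
rewrite (eq_bigr (fun b => (v b).+1%:R / \sum_(c : A) (v c).+1%:R)); last first.
  move=> b _; rewrite /code_len opprB expRD expRN !lnK ?posrE ?ltr0n//.
  exact: S0 b.
by rewrite -mulr_suml mulfV// gt_eqF// (S0 v a).
Qed.

(** Round [K p] down to integers; the successor in [code_len] keeps every weight positive. The total
    weight is then at most [K + #|A|], so the loss is at most [#|A| / K], and [K] is chosen to make
    this at most [e]. *)
Lemma exists_code (p : A -> R) (e : R) : 0 < e -> (forall b, 0 <= p b) ->
  \sum_b p b = 1 ->
  exists v, \sum_b p b * code_len v b <= \sum_b ent_phi (p b) + e.
Proof.
move=> e0 p0 p1; pose K := (Num.bound (#|A|%:R / e)).+1.
have K0 : 0 < K%:R :> R by rewrite ltr0n.
have Ke : #|A|%:R / K%:R <= e.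
  rewrite ler_pdivrMr// mulrC -ler_pdivrMr//; apply: ltW.
  apply: lt_trans (archi_boundP _) _; first by rewrite divr_ge0// ltW.
  by rewrite ltr_nat.
pose v : {ffun A -> nat} := [ffun b => Num.truncn (K%:R * p b)].
have Kp0 b : 0 <= K%:R * p b by rewrite mulr_ge0.
have vlo b : K%:R * p b <= (v b).+1%:R.
  by rewrite ffunE; have /andP[_ /ltW] := truncn_itv (Kp0 b).
have vhi b : (v b).+1%:R <= K%:R * p b + 1.
  by rewrite ffunE -natr1 lerD2r; have /andP[] := truncn_itv (Kp0 b).
exists v; set S : R := \sum_(c : A) (v c).+1%:R.
have SK : S <= K%:R + #|A|%:R.
  apply: le_trans (ler_sum _ (fun b _ => vhi b)) _.
  by rewrite big_split/= -mulr_sumr p1 mulr1 sumr_const.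
have KS : K%:R <= S.
  rewrite (_ : K%:R = \sum_b K%:R * p b); last by rewrite -mulr_sumr p1 mulr1.
  by apply: ler_sum => b _; exact: vlo.
have S0' : 0 < S by exact: lt_le_trans K0 KS.
have lnS : ln S - ln K%:R <= e.
  rewrite -ln_div ?posrE//; apply: le_trans (ln_le_sub1 _) _; first by rewrite divr_gt0.
  apply: le_trans Ke; rewrite lerBlDr -[X in _ <= _ + X](@mulfV _ K%:R) ?gt_eqF//.
  by rewrite -mulrDl ler_pM2r ?invr_gt0// addrC.
apply: (@le_trans _ _ (\sum_b (ent_phi (p b) + p b * e))); last first.
  by rewrite big_split/= -mulr_suml p1 mul1r.
apply: ler_sum => b _; rewrite ent_phiE /code_len -/S.
have [->|pn0] := eqVneq (p b) 0; first by rewrite !mul0r oppr0 addr0.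
have pp : 0 < p b by rewrite lt_neqAle eq_sym pn0 p0.
have : ln K%:R + ln (p b) <= ln (v b).+1%:R.
  by rewrite -lnM ?posrE// ler_ln ?posrE ?mulr_gt0 ?ltr0n.
move=> h; have : p b * (ln S - ln (v b).+1%:R) <= p b * (e - ln (p b)).
  by rewrite ler_wpM2l//; lra.
by rewrite mulrBr; lra.
Qed.

End Codes.

(** * Bowen's topological entropy of a set *)

Section Covers.
Context {R : realType} {d : measure_display} {X : measurableType d}.
Variables (dist : X -> X -> R) (T : X -> X) (eps s : R).
Local Notation Hsn Z n := (Hsn dist T Z eps s n).
Local Notation Hs Z := (Hs dist T Z eps s).
Local Notation weight m := (expR (- (s * m%:R)))%:E.

Lemma Hsn_ge0 Z n : (0 <= Hsn Z n)%E.
Proof.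
apply: le_ereal_inf_tmp; move=> /= _ [I [c [m [_ _ ->]]]].
by apply: esum_ge0 => i _; rewrite lee_fin expR_ge0.
Qed.

(** Covers in [Hsn] are indexed by sets of naturals; transport along [pickle] allows any countable
    index type. *)
Lemma Hsn_le_esum (K : countType) (D : set K) (c : K -> X) (m : K -> nat) Z n :
  (forall k, D k -> (n <= m k)%N) ->
  Z `<=` \bigcup_(k in D) bowen_ball dist T (m k) (c k) eps ->
  (Hsn Z n <= \esum_(k in D) weight (m k))%E.
Proof.
move=> nm Zc; apply: ereal_inf_lbound.
pose c' i := oapp c point (unpickle i : option K).
pose m' i := oapp m 0%N (unpickle i : option K).
exists (pickle @` D), c', m'; split.
- by move=> _ [k Dk <-]; rewrite /m' pickleK; exact: nm.
- move=> x /Zc[k Dk xk]; exists (pickle k); first by exists k.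
  by rewrite /c' /m' pickleK.
- rewrite esum_image; last by move=> k k' _ _; exact: (pcan_inj pickleK).
  by apply: eq_esum => k _; rewrite /m' pickleK.
Qed.

Lemma le_Hsn Z Z' n : Z `<=` Z' -> (Hsn Z n <= Hsn Z' n)%E.
Proof.
move=> ZZ'; apply: le_ereal_inf_tmp; move=> /= _ [I [c [m [nm Z'c ->]]]].
apply: ereal_inf_lbound; exists I, c, m; split => //; exact: subset_trans Z'c.
Qed.

Lemma Hsn_bigcup (Z : nat -> set X) n :
  (Hsn (\bigcup_i Z i) n <= \sum_(i <oo) Hsn (Z i) n)%E.
Proof.
(* Near-optimal covers with errors [e / 2 ^ i.+1] exist only when every term is finite. *)
have [[i Zioo]|noo] := pselect (exists i, Hsn (Z i) n = +oo%E).
  rewrite (eseries_pinfty (u_ := fun j => Hsn (Z j) n) _ _ Zioo) ?leey// => j _.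
  by rewrite -ltNye (lt_le_trans _ (Hsn_ge0 _ _)).
apply/lee_addgt0Pr => e e0.
rewrite (le_trans _ (epsilon_trick _ (fun i => Hsn_ge0 _ _) (ltW e0)))//.
have /choice[f fP] : forall i, exists Icm : set nat * (nat -> X) * (nat -> nat),
    [/\ (forall j, Icm.1.1 j -> (n <= Icm.2 j)%N),
        Z i `<=` \bigcup_(j in Icm.1.1) bowen_ball dist T (Icm.2 j) (Icm.1.2 j) eps &
        (\esum_(j in Icm.1.1) weight (Icm.2 j) <= Hsn (Z i) n + (e / (2 ^ i.+1)%:R)%:E)%E].
  move=> i; have Zfin : Hsn (Z i) n \is a fin_num.
    rewrite ge0_fin_numE ?Hsn_ge0// ltey; apply/eqP => Zioo; apply: noo; by exists i.
  have ei : 0 < e / (2 ^ i.+1)%:R by apply: divr_gt0 => //; rewrite ltr0n expn_gt0.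
  have [_ [I [c [m [nm Zc ->]]]] /ltW lee] := lb_ereal_inf_adherent ei Zfin.
  by exists (I, c, m).
pose K : set (nat * nat) := [set: nat] `*`` (fun i => (f i).1.1).
apply: (@le_trans _ _ (\esum_(k in K) weight ((f k.1).2 k.2))%E).
  apply: (@Hsn_le_esum _ K (fun k => (f k.1).1.2 k.2) (fun k => (f k.1).2 k.2)).
    by move=> [i j] [_ /= ij]; case: (fP i) => + _ _; apply.
  move=> x [i _ Zx]; have [_ /(_ _ Zx)[j ij xj] _] := fP i.
  by exists (i, j).
rewrite -(@esum_esum _ _ _ setT (fun i => (f i).1.1) (fun i j => weight ((f i).2 j))); last first.
  by move=> i j _ _; rewrite lee_fin expR_ge0.
rewrite nneseries_esumT; last first.
  move=> i; rewrite adde_ge0 ?Hsn_ge0// lee_fin divr_ge0// ltW//.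
by apply: le_esum => i _; case: (fP i).
Qed.

Lemma Hsn_finite (F : finType) (D : {set F}) (c : F -> X) (m n : nat) Z : (n <= m)%N ->
  Z `<=` \bigcup_(f in [set` D]) bowen_ball dist T m (c f) eps ->
  (Hsn Z n <= (#|D|%:R * expR (- (s * m%:R)))%:E)%E.
Proof.
move=> nm Zc; apply: le_trans (@Hsn_le_esum _ [set` D] c (fun=> m) Z n _ Zc) _ => //.
rewrite esum_fset; [|exact: finite_finset|by move=> i _; rewrite lee_fin expR_ge0].
rewrite (fsbigE (enum D)) ?enum_uniq//.
- rewrite big_enum_cond/= sumEFin lee_fin mulr_natl -sumr_const.
  rewrite le_eqVlt; apply/orP; left; apply/eqP; apply: eq_bigl => i.
  by rewrite mem_setE andbb.
- by move=> i /=; rewrite mem_enum.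
- by move=> i /=; rewrite mem_enum => ->.
Qed.

Lemma Hs_eq0 Z : (forall n, Hsn Z n = 0%E) -> Hs Z = 0%E.
Proof.
move=> Z0; apply/eqP; rewrite eq_le; apply/andP; split.
  by apply: ge_ereal_sup => _ [n _ <-]; rewrite Z0.
by apply: ereal_sup_ubound; exists 0%N.
Qed.

Lemma Hsn_eq0 Z n : Hs Z = 0%E -> Hsn Z n = 0%E.
Proof.
move=> Z0; apply/eqP; rewrite eq_le Hsn_ge0 andbT -Z0.
by apply: ereal_sup_ubound; exists n.
Qed.

Lemma Hs_bigcup (K : countType) (Z : K -> set X) :
  (forall k, Hs (Z k) = 0%E) -> Hs (\bigcup_k Z k) = 0%E.
Proof.
move=> Z0; apply: Hs_eq0 => n; apply/eqP; rewrite eq_le Hsn_ge0 andbT.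
(* Integers that encode no [k] receive the empty set, which the empty family covers. *)
pose Z' (i : nat) := oapp Z set0 (unpickle i).
apply: (@le_trans _ _ (Hsn (\bigcup_i Z' i) n)).
  by apply: le_Hsn => x [k _ Zx]; exists (pickle k) => //; rewrite /Z' pickleK.
apply: le_trans (Hsn_bigcup _ _) _; rewrite eseries0// => i _ _.
rewrite /Z'; case: unpickle => [k|] /=; first exact: Hsn_eq0.
apply/eqP; rewrite eq_le Hsn_ge0 andbT.
apply: le_trans (@Hsn_le_esum _ (set0 : set nat) (fun=> point) id set0 n _ _) _ => //.
by rewrite esum_set0.
Qed.

(** A Borel-Cantelli argument: [Z] lies in the union of the [Y k] over [k >= M], whose cost is a
    geometric tail. *)
Lemma Hs_limsup Z (Y : nat -> set X) (C rho : R) : 0 <= C -> 0 < rho -> rho < 1 ->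
  (forall n k, (n <= k)%N -> (Hsn (Y k) n <= (C * rho ^+ k)%:E)%E) ->
  (forall x, Z x -> forall M, exists2 k, (M <= k)%N & Y k x) -> Hs Z = 0%E.
Proof.
move=> C0 rho0 rho1 HY ZY; apply: Hs_eq0 => n; apply/eqP.
rewrite eq_le Hsn_ge0 andbT; apply/lee_addgt0Pr => e e0; rewrite add0e.
pose D := C * (1 - rho)^-1.
have rho1' : 0 < 1 - rho by lra.
have D0 : 0 <= D by rewrite mulr_ge0// invr_ge0 ltW.
have nrho : `|rho| < 1 by rewrite ger0_norm// ltW.
have [M [nM DM]] : exists M, (n <= M)%N /\ D * rho ^+ M < e.
  have /cvgrPdist_lt/(_ _ e0) := cvg_geometric D nrho.
  move=> /(filterI (nbhs_infty_ge n))/filter_ex[M [/= nM h]]; exists M; split => //.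
  by move: h; rewrite sub0r normrN ger0_norm// mulr_ge0// exprn_ge0// ltW.
apply: (@le_trans _ _ (Hsn (\bigcup_i Y (M + i)%N) n)).
  apply: le_Hsn => x /ZY/(_ M)[k Mk Yk]; exists (k - M)%N => //.
  by rewrite subnKC.
apply: le_trans (Hsn_bigcup _ _) _.
apply: lime_le; first by apply: is_cvg_nneseries => i _ _; exact: Hsn_ge0.
apply: nearW => j; apply: (@le_trans _ _ (\sum_(0 <= i < j) (C * rho ^+ M * rho ^+ i)%:E)%E).
  apply: lee_sum => i _; rewrite -mulrA -exprD; apply: HY.
  exact: leq_trans nM (leq_addr _ _).
rewrite sumEFin lee_fin; apply: le_trans (ltW DM).
apply: le_trans (geometric_le_lim j _ rho0 nrho) _; first by rewrite mulr_ge0// exprn_ge0// ltW.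
by rewrite /D mulrAC.
Qed.

End Covers.

Lemma le_htop (R : realType) (d : measure_display) (X : measurableType d)
    (dist : X -> X -> R) (T : X -> X) (Z Z' : set X) :
  Z `<=` Z' -> (htop dist T Z <= htop dist T Z')%E.
Proof.
move=> ZZ'; apply: ge_ereal_sup => _ [eps eps0 <-].
apply: (@le_trans _ _ (htop_eps dist T Z' eps)); last by apply: ereal_sup_ubound; exists eps.
apply: le_ereal_inf_tmp; move=> _ /= [s [s0 Hs0] <-]; apply: ereal_inf_lbound; exists s => //.
split => //; apply: Hs_eq0 => n; apply/eqP; rewrite eq_le Hsn_ge0 andbT.
by rewrite -(Hsn_eq0 n Hs0); exact: le_Hsn.
Qed.

(** * Counting itineraries *)

Lemma sum_blocks (R : realType) (G : nat -> R) (N k : nat) :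
  \sum_(j < k * N) G j = \sum_(l < N) \sum_(i < k) G (l + i * N)%N.
Proof.
elim: k => [|k IH].
  by rewrite big_ord0 big1// => l _; rewrite big_ord0.
rewrite mulSnr big_split_ord/= IH -big_split/=; apply: eq_bigr => l _.
by rewrite big_ord_recr/= addnC.
Qed.

(** Pigeonhole over the [N] offsets: together their block sums make up one sum over times below n.
    If all exceeded the bound, that sum would be too large, because n is at most
    [(n %/ N).+1 * N]. *)
Lemma exists_offset (R : realType) (G : nat -> R) (N n : nat) (tau : R) :
  (0 < N)%N -> 0 <= tau -> (forall j, 0 <= G j) ->
  \sum_(j < n) G j <= n%:R * (N%:R * tau) ->
  exists l : 'I_N, \sum_(i < n %/ N) G (l + i * N)%N <= (n %/ N).+1%:R * (N%:R * tau).
Proof.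
move=> N0 tau0 G0 Gn; apply: contrapT => /forallNP H.
set k := (n %/ N)%N in H *.
have nk : (n <= k.+1 * N)%N by rewrite mulSnr {1}(divn_eq n N) leq_add2l ltnW ?ltn_pmod.
have : \sum_(j < k * N) G j <= k.+1%:R * N%:R * (N%:R * tau).
  apply: (@le_trans _ _ (\sum_(j < n) G j)).
    rewrite [in leRHS](divn_eq n N) big_split_ord/= lerDl; exact: sumr_ge0.
  apply: le_trans Gn _; rewrite ler_wpM2r ?mulr_ge0//.
  by rewrite -natrM ler_nat.
rewrite sum_blocks leNgt => /negP; apply.
apply: (@le_lt_trans _ _ (\sum_(l < N) k.+1%:R * (N%:R * tau))).
  rewrite sumr_const card_ord -mulr_natl le_eqVlt; apply/orP; left; apply/eqP; ring.
apply: ltr_sum => [|l _]; first by apply/hasP; exists (Ordinal N0); rewrite ?mem_index_enum.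
by rewrite ltNge; apply/negP; exact: H.
Qed.

Section Itineraries.
Context {R : realType} {d : measure_display} {X : measurableType d}.
Variables (dist : X -> X -> R) (T : X -> X).
Hypothesis hm : is_metric dist.
Variables (q : nat) (z : 'I_q -> X) (eps : R).
Hypothesis eps0 : 0 < eps.
Variables (N : nat) (v : {ffun {ffun 'I_N -> 'I_q} -> nat}) (tau : R).
Hypotheses (N0 : (0 < N)%N) (tau0 : 0 <= tau).
Local Notation W := {ffun 'I_N -> 'I_q}.
Local Notation code k := ('I_N * W * {ffun 'I_k -> W})%type.

(* An itinerary of length at least [k * N] is cut into a prefix of length
   [f.1.1 < N] and [k] blocks of length [N]. *)
Definition coded k (f : code k) (x : X) : Prop :=
  (forall j : 'I_N, (j < f.1.1)%N -> dist (z (f.1.2 j)) (iter j T x) < eps / 2) /\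
  (forall (i : 'I_k) (p : 'I_N), dist (z (f.2 i p)) (iter (f.1.1 + i * N + p) T x) < eps / 2).

Definition good k : {set code k} :=
  finset (fun f : code k => \sum_i code_len (R := R) v (f.2 i) <= k.+1%:R * (N%:R * tau)).

Definition good_points k : set X := [set x | exists2 f, f \in good k & coded f x].

(** At each time before [k * N], read from the prefix or from a block, a common code puts both
    orbits within [eps / 2] of the same point [z]. *)
Lemma coded_bowen k (f : code k) x y : coded f x -> coded f y ->
  bowen_ball dist T (k * N) x eps y.
Proof.
move=> [x1 x2] [y1 y2]; rewrite /bowen_ball/= /bowen_dist; apply: bigmax_lt => // j _.
have [_ _ sym tri] := hm.
suff [c [cx cy]] : exists c, dist c (iter j T x) < eps / 2 /\ dist c (iter j T y) < eps / 2.
  by apply: le_lt_trans (tri _ c _) _; rewrite sym; lra.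
have [jl|lj] := ltnP j f.1.1.
  have jN : (j < N)%N by exact: ltn_trans jl (ltn_ord f.1.1).
  by exists (z (f.1.2 (Ordinal jN))); split; [exact: (x1 (Ordinal jN))|exact: (y1 (Ordinal jN))].
have ik : ((j - f.1.1) %/ N < k)%N.
  by rewrite ltn_divLR//; apply: leq_ltn_trans (ltn_ord j); exact: leq_subr.
have pN : ((j - f.1.1) %% N < N)%N by rewrite ltn_pmod.
exists (z (f.2 (Ordinal ik) (Ordinal pN))).
have := x2 (Ordinal ik) (Ordinal pN); have := y2 (Ordinal ik) (Ordinal pN).
by rewrite /= -addnA -divn_eq subnKC.
Qed.

(** Each good code contributes at least 1 to the sum of [expR B] times the product of its block
    weights. Summed over all choices of blocks, the products factor into [k] Kraft sums; prefixes
    account for [N * #|{: W}|]. *)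
Lemma card_good k : #|good k|%:R <=
  (N * #|{: W}|)%:R * expR (k.+1%:R * (N%:R * tau)) :> R.
Proof.
set B := k.+1%:R * _.
have -> : #|good k|%:R = \sum_(f in good k) 1 :> R by rewrite sumr_const.
apply: (@le_trans _ _ (\sum_(f : code k) expR B * \prod_i expR (- code_len (R := R) v (f.2 i)))).
  rewrite big_mkcond/=; apply: ler_sum => f _; case: ifP => [|_]; last first.
    by rewrite mulr_ge0 ?expR_ge0// prodr_ge0// => i _; rewrite expR_ge0.
  rewrite inE => fB; rewrite -expR_sum -expRD -[leLHS]expR0 ler_expR sumrN.
  by rewrite subr_ge0.
rewrite -mulr_sumr mulrC ler_wpM2r ?expR_ge0//.
rewrite -(pair_bigA _ (fun (_ : 'I_N * W) (c : {ffun 'I_k -> W}) =>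
   \prod_i expR (- code_len (R := R) v (c i))))/=.
rewrite sumr_const card_prod card_ord; apply: ler_wMn2r.
rewrite -(bigA_distr_bigA (fun (i : 'I_k) (b : W) => expR (- code_len (R := R) v b))).
rewrite prodr_const card_ord exprn_ile1 ?kraft//.
by apply: sumr_ge0 => b _; exact: expR_ge0.
Qed.

Lemma Hsn_good_points (s : R) n k : (n <= k)%N ->
  (Hsn dist T (good_points k) eps s n <=
   ((N * #|{: W}|)%:R * expR (N%:R * tau) * expR (- ((s - tau) * N%:R)) ^+ k)%:E)%E.
Proof.
move=> nk.
(* Bowen balls must be centred at points of [X]: any point with code [f] will do, and the default is
   taken only when no point has that code. *)
pose c (f : code k) := xget point [set x | coded f x].
apply: (@le_trans _ _ (#|good k|%:R * expR (- (s * (k * N)%:R)))%:E).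
  apply: (@Hsn_finite _ _ _ _ _ _ _ _ (good k) c); first by rewrite (leq_trans nk)// leq_pmulr.
  move=> x [f gf fx]; exists f => //; apply: (@coded_bowen _ f) => //.
  exact: (xgetPex point (ex_intro (fun y => coded f y) x fx)).
rewrite lee_fin; apply: le_trans (ler_wpM2r (expR_ge0 _) (card_good k)) _.
rewrite -!mulrA ler_wpM2l// -expRM_natl -!expRD ler_expR natrM -natr1; lra.
Qed.

Lemma Hs_good_points (s : R) : tau < s ->
  Hs dist T [set x | forall M, exists2 k, (M <= k)%N & good_points k x] eps s = 0%E.
Proof.
move=> ts; apply: (@Hs_limsup _ _ _ _ _ _ _ _ good_points
  ((N * #|{: W}|)%:R * expR (N%:R * tau)) (expR (- ((s - tau) * N%:R)))) => //.
- exact: expR_gt0.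
- by rewrite expR_lt1 oppr_lt0 mulr_gt0 ?subr_gt0 ?ltr0n.
- by move=> n k; exact: Hsn_good_points.
Qed.

End Itineraries.

(** * Bowen's upper bound and the theorem *)

Section UpperBound.
Context {R : realType} {d : measure_display} {X : measurableType d}.
Variables (dist : X -> X -> R) (T : X -> X).
Hypotheses (hm : is_metric dist) (hc : mcompact dist) (hb : borel_of dist).
Hypothesis hT : mcont dist T.

Lemma mcont_iter n : mcont dist (iter n T).
Proof.
elim: n => [|n IH] x e e0; first by exists e.
have [d1 d10 d1P] := hT (iter n T x) e0; have [d2 d20 d2P] := IH x d1 d10.
by exists d2 => // y /d2P; exact: d1P.
Qed.

(** Enlarge each ball to a radius in (a,b) whose sphere is null: the balls still cover and stay
    smaller than [b]. The label depends only on the finite list of memberships, each of which is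
    tame. *)
Lemma exists_tame_label (mu : probability X R) (q : nat) (z : 'I_q -> X) (a b : R) :
  a < b -> (forall x, exists j, dist (z j) x < a) ->
  exists label : X -> 'I_q, tame dist mu label /\ forall y, dist (z (label y)) y < b.
Proof.
move=> ab za.
have /choice[r rP] : forall i, exists r, a < r < b /\ mu [set y | dist (z i) y = r] = 0%E.
  by move=> i; exact: exists_null_sphere.
(* A default for [pick], never reached on actual points since the balls cover. *)
have [i0 _] := za point.
pose h (S : {ffun 'I_q -> bool}) : 'I_q := odflt i0 [pick i | S i].
pose S y : {ffun 'I_q -> bool} := [ffun i => dist (z i) y < r i].
exists (h \o S); split.
  apply: tame_comp; apply: (@tame_ffun _ _ _ dist hb mu q bool (fun i y => dist (z i) y < r i)) => i.
  by apply: tame_ball => //; case: (rP i).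
move=> y; rewrite /h /=; case: pickP => [i|H] /=.
  by rewrite ffunE => /lt_trans; apply; case: (rP i) => /andP[].
have [j zj] := za y; have := H j; rewrite ffunE.
by rewrite (lt_trans zj)//; case: (rP j) => /andP[].
Qed.

Lemma exists_good_points (x : X) (mu : probability X R) (U : set_system nat)
    (UU : UltraFilter U) (q : nat) (z : 'I_q -> X) (eps t e : R) :
  eventually `<=` U -> Defs.invariant T mu ->
  (forall G, mopen dist G -> (mu G <= (omean T x U (\1_G))%:E)%E) ->
  0 < eps -> (forall y, exists j, dist (z j) y < eps / 4) ->
  0 <= t -> (hmu T mu <= t%:E)%E -> 0 < e ->
  exists N' (v : {ffun {ffun 'I_N'.+1 -> 'I_q} -> nat}), forall M,
    exists2 k, (M <= k)%N & good_points dist T z eps v (t + e) k x.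
Proof.
move=> ooU invT muL eps0 zP t0 ht e0.
have mL : mean (omean T x U : (X -> R) -> R) := omean_mean T x UU ooU.
have [|label [tl lz]] := @exists_tame_label mu q z (eps / 4) (eps / 2) _ zP; first by lra.
have ml : mlabel label by case: tl.
have mT := mcont_measurable hb hT.
have hp : hpart T mu (label_part label) <= t.
  rewrite -lee_fin; apply: le_trans ht; apply: ereal_sup_ubound.
  by exists q, (label_part label); split => //; exact: label_mpartition.
(* The margin [e] is spent in thirds: one to pass from the limit to a finite [N], one on the code,
   and one to keep [Lg] strict. *)
have hp' : hpart T mu (label_part label) < t + e / 3 by lra.
have [N N0 HN] := exists_Hjoin_lt mT invT ml hp'.
have N0' : 0 < N%:R :> R by rewrite ltr0n.
case: N N0 HN N0' => // N' _ HN N0'; set N := N'.+1 in HN N0' *.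
have Ne : 0 < N%:R * (e / 3) by rewrite mulr_gt0// divr_gt0.
have [v vP] := exists_code Ne (@winprob_ge0 _ _ _ T mu q label N) (winprob_sum mu mT ml N).
exists N', v => M.
pose g (b : {ffun 'I_N -> 'I_q}) : R := code_len v b.
have tw : tame dist mu (win T label N).
  apply: (@tame_ffun _ _ _ dist hb mu N 'I_q (fun j y => label (iter j T y))) => j.
  apply: (tame_preimage hb (mcont_iter j) _ tl) => A mA.
  exact: iter_invariant.
have gb : bnd (g \o win T label N).
  exists (\sum_b g b) => y; rewrite ger0_norm; last exact: code_len_ge0.
  rewrite (bigD1 (win T label N y))//= lerDl sumr_ge0// => b _; exact: code_len_ge0.
have Lg : omean T x U (g \o win T label N) < N%:R * (t + e).
  rewrite (mean_tame hb mL muL _ tw).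
  apply: (@le_lt_trans _ _ (Hjoin T mu N (label_part label) + N%:R * (e / 3))).
    rewrite Hjoin_win; apply: le_trans vP; apply: ler_sum => b _.
    by rewrite mulrC.
  by move: HN Ne; move: (N%:R : R) (Hjoin _ _ _ _) => a b; lra.
(* The slack in [Lg] is the tolerance, so averages stay below [N (t + e)] at [U]-almost every time.
   Asking also for [n >= M.+1 * N] makes n positive and gives at least [M] blocks. *)
have /cvgrPdist_lt := @avg_omean _ _ T x U UU _ gb.
move=> /(_ (N%:R * (t + e) - omean T x U (g \o win T label N))).
rewrite subr_gt0 => /(_ Lg)/filterI/(_ (ooU _ (nbhs_infty_ge (M.+1 * N)))).
move=> /filter_ex[n [/= avgn nM]].
have n0 : (0 < n)%N by rewrite (leq_trans _ nM)// muln_gt0.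
have sum_n : \sum_(j < n) (g \o win T label N) (iter j T x) <= n%:R * (N%:R * (t + e)).
  rewrite -ler_pdivrMl ?ltr0n//; move: avgn; rewrite ltr_norml => /andP[h _].
  by apply: ltW; move: h; rewrite /avg; lra.
have [l lP] := exists_offset (isT : (0 < N)%N) (addr_ge0 t0 (ltW e0))
  (fun j => code_len_ge0 v (win T label N (iter j T x))) sum_n.
exists (n %/ N)%N; first by rewrite leq_divRL// (leq_trans _ nM)// leq_pmul2r.
(* The prefix is a full word of length [N], of which only the first [l] letters are read. *)
exists (l, win T label N x, [ffun i : 'I_(n %/ N) => win T label N (iter (l + i * N) T x)]).
  by rewrite inE /=; under eq_bigr do rewrite ffunE.
split => [j _|i p] /=; rewrite !ffunE; first exact: lz.
by rewrite -iterD addnC; exact: lz.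
Qed.

End UpperBound.

Theorem theorem1p1 (R : realType) (d : measure_display) (X : measurableType d)
  (dist : X -> X -> R) (T : X -> X)
  (hmetric : is_metric dist) (hcompact : mcompact dist)
  (hborel : borel_of dist) (hT : mcont dist T)
  (hsat : saturated dist T)
  (r : nat) (hr : (1 <= r)%N) (Phi : ('I_r -> X) -> R)
  (hPhi : mcont_prod dist Phi) (alpha : R) :
  (M_Phi T Phi alpha = set0 -> E_Phi T Phi alpha = set0) /\
  (M_Phi T Phi alpha <> set0 ->
     htop dist T (E_Phi T Phi alpha) =
     ereal_sup [set hmu T mu | mu in M_Phi T Phi alpha]).
Proof.
have [U UU ooU] := exists_ultra_infty.
have UP : ProperFilter U by exact: ultra_proper.
have limE x : E_Phi T Phi alpha x -> exists2 mu, M_Phi T Phi alpha mu &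
    forall G, mopen dist G -> (mu G <= (omean T x U (\1_G : X -> R))%:E)%E.
  move=> Ex; have [mu [invT mucvg muL]] := limit_measure hmetric hcompact hborel hT UU ooU x.
  exists mu => //; split => //.
  have h1 := ravg_cvg hmetric hcompact hborel UP ooU mucvg hPhi.
  have h2 : ravg T Phi x @ U --> alpha.
    apply: cvg_trans Ex; move=> A /=; exact: ooU.
  exact: (cvg_unique (F := ravg T Phi x @ U) _ h1 h2).
split => [M0|MN].
  by rewrite -subset0 => x /limE[mu]; rewrite M0.
apply/eqP; rewrite eq_le; apply/andP; split; last first.
  apply: ge_ereal_sup; move=> _ [mu [invT muPhi] <-]; rewrite -hsat//; apply: le_htop => x gx.
  rewrite /E_Phi/= -muPhi.
  (* At a generic point the filter is [\oo] itself, so the multiple averages converge in the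
     ordinary sense. *)
  exact: (ravg_cvg hmetric hcompact hborel _ (fun _ => id) gx hPhi).
set h := ereal_sup _.
have hge mu : M_Phi T Phi alpha mu -> (hmu T mu <= h)%E.
  by move=> Mmu; apply: ereal_sup_ubound; exists mu.
have h0 : (0 <= h)%E.
  have /set0P[mu Mmu] : M_Phi T Phi alpha != set0 by exact/eqP.
  exact: le_trans (hmu_ge0 T mu) (hge mu Mmu).
(* An infinite supremum leaves nothing to prove, and nonnegativity of entropy excludes minus
   infinity. *)
case: h hge h0 => [t hge|_ _|//]; last by rewrite leey.
rewrite lee_fin => t0; apply: ge_ereal_sup; move=> _ [eps /= eps0 <-].
apply/lee_addgt0Pr => e e0; rewrite -EFinD.
have e20 : 0 < e / 2 by lra.
have te0 : 0 <= t + e / 2 by lra.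
apply: ereal_inf_lbound; exists (t + e) => //=; split; first by lra.
have [|q [z zP]] := mcompact_net hmetric hcompact (e := fun=> eps / 4); first by move=> _; lra.
(* The measure depends on [x], but the pair of a block length and an integer code vector ranges over
   a countable type. Using [N'.+1] builds positivity of the length into the index. *)
pose K : countType := {N' : nat & {ffun {ffun 'I_N'.+1 -> 'I_q} -> nat}}.
pose Z (k : K) := [set x | forall M, exists2 n, (M <= n)%N &
  good_points dist T z eps (projT2 k) (t + e / 2) n x].
(* The growth rate [t + e / 2] of the good codes lies strictly below the exponent [t + e]. *)
have Z0 : Hs dist T (\bigcup_k Z k) eps (t + e) = 0%E.
  apply: Hs_bigcup => -[N' v]; apply: Hs_good_points => //; lra.
apply: Hs_eq0 => n; apply/eqP; rewrite eq_le Hsn_ge0 andbT -(Hsn_eq0 n Z0).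
apply: le_Hsn => x /limE[mu Mmu muL].
have [N' [v vP]] := exists_good_points hmetric hborel hT UU ooU Mmu.1 muL eps0 zP t0 (hge mu Mmu) e20.
by exists (existT _ N' v).
Qed.
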